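(* Let $A$ be a self-adjoint operator on an infinite-dimensional Hilbert space $\mathcal{H}$, let $a<b$ be real numbers with $(a,b)\cap\sigma_{\mathrm{ess}}(A)=\emptyset$ and $b\in\sigma_{\mathrm{ess}}(A)$, let $\kappa\ge0$, and let $B$ be a bounded symmetric operator on $\mathcal{H}$ satisfying $0\le B$ and $\lVert B\rVert<b-a$. Assume that $$\forall x\in\bigcup_{t\in[0,1]}\operatorname{Ran}P_{A+tB}(b+\lVert B\rVert):\quad\langle x,Bx\rangle\ge\kappa\lVert x\rVert^2.$$ Then $[b,b+\kappa)\cap\sigma_{\mathrm{ess}}(A+B)=\emptyset$.
   Context: $P_A(E)=\mathbf{1}_{(-\infty,E]}(A)$ is the spectral projection of a self-adjoint operator $A$; $\sigma_{\mathrm{ess}}$ denotes the essential spectrum. $A$ need not be semi-bounded.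
   Formalization: It is additionally assumed that κ = 0 if B = 0; otherwise the claim fails, e.g. for A = multiplication by x on L²(0,1), a = -1, b = 0, B = 0, κ = 1, where the lower-bound assumption is void. *)

(* Defs.v *)
From HB Require Import structures.
From mathcomp Require Import all_boot all_order all_algebra.
From mathcomp Require Export complex.
From mathcomp Require Import all_classical all_reals all_analysis.

Set Implicit Arguments.
Unset Strict Implicit.
Unset Printing Implicit Defensive.

Import Order.TTheory GRing.Theory Num.Theory.
Import numFieldNormedType.Exports.

Local Open Scope classical_set_scope.
Local Open Scope complex_scope.
Local Open Scope ring_scope.

(* Complex Hilbert spaces. Norms of a normed module over R[i] have values in
   R[i]; they are nonnegative reals for the order of R[i]. The inner product is
   linear in its first argument and conjugate-linear in the second one. *)
HB.mixin Record isHilbert (R : realType) (H : Type)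
    of CompleteNormedModule R[i] H := {
  hdot : {dot H for (@Num.conj R[i])} ;
  hdot_norm : forall x : H, hdot x x = `|x| ^+ 2 }.

#[short(type="hilbertType")]
HB.structure Definition Hilbert (R : realType) :=
  { H of CompleteNormedModule R[i] H & isHilbert R H }.

Notation "''[' x , y ]" := (hdot x y)
  (format "''['  x ,  y  ]") : ring_scope.

Section dimension.
Context {R : realType} {H : hilbertType R}.

Definition finite_dimensional (V : set H) :=
  exists (n : nat) (e : 'I_n -> H), forall x, V x ->
    exists c : 'I_n -> R[i], x = \sum_(i < n) c i *: e i.

End dimension.

Section bounded_operators.
Context {R : realType} {H : hilbertType R}.
Implicit Type B : H -> H.

Definition bounded_op B :=
  exists M : R, forall x, `|B x| <= M%:C * `|x|.

Definition opnorm B : R :=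
  sup [set complex.Re `|B x| | x in [set x : H | `|x| <= 1]].

Definition symmetric_op B := forall x y, '[B x, y] = '[x, B y].

Definition nonneg_op B := forall x, 0 <= '[x, B x].

Definition orthogonal_projection B :=
  [/\ linear B, (forall x, B (B x) = B x) & symmetric_op B].

End bounded_operators.

(* Possibly unbounded linear operators; the values of opfun outside of the
   domain are irrelevant. *)
Record operator (R : realType) (H : hilbertType R) := Operator {
  dom : set H ;
  opfun :> H -> H ;
  dom0 : dom 0 ;
  dom_linear : forall (k : R[i]) x y, dom x -> dom y -> dom (k *: x + y) ;
  op_linear : forall (k : R[i]) x y, dom x -> dom y ->
    opfun (k *: x + y) = k *: opfun x + opfun y }.

Section unbounded_operators.
Context {R : realType} {H : hilbertType R}.
Implicit Types (A : operator H) (B : {linear H -> H}).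

Fact op_add_linear A B (k : R[i]) x y : dom A x -> dom A y ->
  A (k *: x + y) + B (k *: x + y) = k *: (A x + B x) + (A y + B y).
Proof.
by move=> Ax Ay; rewrite op_linear// linearP scalerDr addrACA.
Qed.

Definition op_add A B : operator H :=
  Operator (dom0 A) (@dom_linear _ _ A) (op_add_linear (A := A) B).

Definition graph A : set (H * H) := [set u | dom A u.1 /\ u.2 = A u.1].

Definition adjoint_graph A : set (H * H) :=
  [set u | forall x, dom A x -> '[A x, u.1] = '[x, u.2]].

Definition self_adjoint A := dense (dom A) /\ adjoint_graph A = graph A.

Definition resolvent_set A : set R[i]^o :=
  [set z | exists2 S : H -> H, bounded_op S &
    (forall x, dom A (S x) /\ A (S x) - z *: S x = x) /\
    (forall x, dom A x -> S (A x - z *: x) = x)].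

Definition spectrum A : set R[i]^o := ~` resolvent_set A.

Definition op_eigenspace A (z : R[i]) : set H :=
  [set x | dom A x /\ A x = z *: x].

Definition discrete_spectrum A : set R[i]^o :=
  [set z | [/\ isolated (spectrum A) z,
               exists2 x, op_eigenspace A z x & x != 0 &
               finite_dimensional (op_eigenspace A z)]].

Definition essential_spectrum A : set R[i]^o :=
  spectrum A `\` discrete_spectrum A.

Definition resolution_of_identity (P : R -> H -> H) :=
  [/\ forall l, orthogonal_projection (P l),
      forall l m x, l <= m -> P l (P m x) = P l x,
      forall l x, P m x @[m --> l^'+] --> P l x,
      forall x, P l x @[l --> -oo] --> (0 : H) &
      forall x, P l x @[l --> +oo] --> x].

(* A is the integral of l dP(l): for all x, with mu the measure d|P(l) x|^2,
   x is in the domain of A iff l^2 is mu-integrable, in which case <x, A x> is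
   the integral of l against mu. By polarization this determines A. *)
Definition spectral_family_of A (P : R -> H -> H) :=
  resolution_of_identity P /\
  forall x, exists mu : {measure set (measurableTypeR R) -> \bar R},
    [/\ forall l : R, (mu `]-oo, l]%classic = (complex.Re `|P l x| ^+ 2)%:E)%E,
        dom A x <-> (\int[mu]_l (l ^+ 2)%:E < +oo)%E &
        dom A x -> '[x, A x] = (\int[mu]_l l)%:C].

(* The projection 1_{(-oo, E]}(A). By the spectral theorem, a self-adjoint
   operator has exactly one spectral family; the default value is irrelevant. *)
Definition spectral_projection A (E : R) : H -> H :=
  xget ((fun _ => id) : R -> H -> H) [set P | spectral_family_of A P] E.

End unbounded_operators.

(* Main.v *)
Require Import Defs.
From mathcomp Require Import all_boot all_order all_algebra.
From mathcomp Require Import all_classical all_reals all_analysis.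
From mathcomp Require Import measurable_realfun unstable ring lra.
Import Order.TTheory GRing.Theory Num.Theory.
Import numFieldNormedType.Exports.

(* For a self-adjoint T, a real number l lies outside the essential spectrum iff
   T - l is bounded below on the orthogonal complement of finitely many vectors;
   in this form the property is stable under bounded perturbations.  If
   0 <= C <= c, then |C - c / 2| <= c / 2, so that a gap (a, b) of the
   essential spectrum of T yields the gap (a + c, b) for T + C.

   The upper edge moves by kappa as follows.  Let N be the norm of B, cut [0, 1]
   into steps of length s, let P be the projection 1_{(-oo, b + N]}(A + t B) and
   Q = 1 - P.  Write s B = s (kappa - eta) - k Q + (s (B - kappa + eta) + k Q).
   Subtracting k Q keeps a gap lying below b + N - k, as P reduces A + t B.  As
   B >= kappa on Ran P, the last term is nonnegative for some eta = O(s / k): for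
   a small fixed k it only moves the lower edge of the gap, by little.  So each
   step raises the upper edge by s kappa - O(s ^ 2), while the part of the gap
   below b is known from the perturbation bound; the total loss is O(s). *)

Local Open Scope classical_set_scope.
Local Open Scope complex_scope.
Local Open Scope ring_scope.

Set Implicit Arguments.
Unset Strict Implicit.
Unset Printing Implicit Defensive.

(** As A need not be semi-bounded, no min-max principle describes the spectrum near b; everything
    goes through norm bounds of T - m around the centre m of a gap. These bounds must be sharp: the
    constant has to be the radius of the gap itself, since a lost factor would spoil the edge b +
    kappa. Sharpness comes from a supremum that improves itself through (T - d)(T + d), without
    functional calculus. Spectral projections enter through two facts only: they reduce the
    operator, and its form is at least E on their kernel. The difficulty there is that a spectral
    family prescribes the diagonal values <x, A x> alone. That b lies in the essential spectrum
    serves to get kappa <= N, which keeps the climbing edge under b + N. *)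

Lemma sqr_le {R : realDomainType} (a b : R) : 0 <= b -> a ^+ 2 <= b ^+ 2 -> a <= b.
Proof.
move=> b0 h; have [a0|/ltW a0] := leP 0 a; last exact: le_trans b0.
by rewrite -ler_sqr.
Qed.

(* H is used as a real Hilbert space, for the real part of its inner product;
   complex orthogonality to v is real orthogonality to both v and 'i *: v. *)
Definition nr {R : realType} {H : hilbertType R} (x : H) : R := complex.Re `|x|.
Definition rip {R : realType} {H : hilbertType R} (x y : H) : R :=
  complex.Re '[x, y].

(** * The real inner product *)

Section real_inner_product.
Context {R : realType} {H : hilbertType R}.
Implicit Types (x y z : H) (a : R).

Lemma normE x : `|x| = (nr x)%:C.
Proof. by rewrite /nr RRe_real// normr_real. Qed.

Lemma nr_ge0 x : 0 <= nr x.
Proof. by rewrite -ler0c -normE. Qed.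

Lemma nrD x y : nr (x + y) <= nr x + nr y.
Proof. by rewrite -lecR rmorphD/= -!normE ler_normD. Qed.

Lemma nrN x : nr (- x) = nr x.
Proof. by rewrite /nr normrN. Qed.

Lemma nrZc (k : R[i]) x : nr (k *: x) = complex.Re `|k| * nr x.
Proof.
apply: (@complexI R); rewrite rmorphM/= -!normE normrZ.
by [].
Qed.

Lemma Re_norm_real a : complex.Re `|a%:C| = `|a|.
Proof. by rewrite normc_def/= expr0n/= addr0 sqrtr_sqr. Qed.

Lemma nrZ a x : nr (a%:C *: x) = `|a| * nr x.
Proof. by rewrite nrZc Re_norm_real. Qed.

Lemma nr_eq0 x : (nr x == 0) = (x == 0).
Proof. by rewrite -(normr_eq0 x) normE -(inj_eq (@complexI R)). Qed.

Lemma nr0 : nr (0 : H) = 0.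
Proof. by apply/eqP; rewrite nr_eq0. Qed.

Lemma rip_nr x : rip x x = nr x ^+ 2.
Proof. by rewrite /rip hdot_norm normE -rmorphXn. Qed.

Lemma hdotC x y : '[x, y] = '[y, x]^*%C.
Proof. by rewrite hermC expr0 mul1r. Qed.

Lemma ripC x y : rip x y = rip y x.
Proof. by rewrite /rip hdotC; case: '[y, x]. Qed.

Lemma ripDl x y z : rip (x + y) z = rip x z + rip y z.
Proof. by rewrite /rip linearDl raddfD. Qed.

Lemma ripZl a x y : rip (a%:C *: x) y = a * rip x y.
Proof.
by rewrite /rip linearZl_LR/=; case: '[x, y] => u v /=; rewrite mul0r subr0.
Qed.

Lemma ripNl x y : rip (- x) y = - rip x y.
Proof. by rewrite /rip linearNl raddfN. Qed.

Lemma ripDr x y z : rip x (y + z) = rip x y + rip x z.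
Proof. by rewrite ripC ripDl !(ripC x). Qed.

Lemma ripZr a x y : rip x (a%:C *: y) = a * rip x y.
Proof. by rewrite ripC ripZl ripC. Qed.

Lemma ripNr x y : rip x (- y) = - rip x y.
Proof. by rewrite ripC ripNl ripC. Qed.

Lemma rip0l x : rip 0 x = 0.
Proof. by rewrite -(scale0r (0 : H)) ripZl mul0r. Qed.

Lemma rip0r x : rip x 0 = 0.
Proof. by rewrite ripC rip0l. Qed.

Definition ripE := (ripDl, ripDr, ripNl, ripNr, ripZl, ripZr).

Lemma rip_ge0 x : 0 <= rip x x.
Proof. by rewrite rip_nr sqr_ge0. Qed.

Lemma rip_ext x y : (forall z, rip x z = rip y z) -> x = y.
Proof.
move=> h; apply/eqP; rewrite -subr_eq0 -nr_eq0 -sqrf_eq0 -rip_nr.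
by rewrite ripDl ripNl h subrr.
Qed.

Lemma rip_extr x y : (forall z, rip z x = rip z y) -> x = y.
Proof. by move=> h; apply: rip_ext => z; rewrite !(ripC _ z). Qed.

Lemma rip_CS x y : rip x y <= nr x * nr y.
Proof.
have [->|y0] := eqVneq y 0; first by rewrite rip0r nr0 mulr0.
have yp : 0 < nr y by rewrite lt_def nr_ge0 nr_eq0 y0.
have [->|x0] := eqVneq x 0; first by rewrite rip0l nr0 mul0r.
have xp : 0 < nr x by rewrite lt_def nr_ge0 nr_eq0 x0.
have := rip_ge0 ((nr y)%:C *: x - (nr x)%:C *: y).
rewrite !ripE !rip_nr (ripC y x) => h.
have {}h : 0 <= (nr x * nr y) * (nr x * nr y - rip x y) by nra.
by rewrite -subr_ge0; rewrite pmulr_rge0 ?mulr_gt0 in h.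
Qed.

Lemma rip_CSabs x y : `|rip x y| <= nr x * nr y.
Proof.
rewrite ler_norml rip_CS andbT -[X in _ <= X]opprK lerN2 -ripNl.
by rewrite (le_trans (rip_CS _ _))// nrN.
Qed.

Lemma rip_pyth x y : rip x y = 0 -> nr (x + y) ^+ 2 = nr x ^+ 2 + nr y ^+ 2.
Proof.
by move=> xy; rewrite -!rip_nr ripDl !ripDr (ripC y) xy addr0 add0r.
Qed.

Lemma rip_i x y : complex.Im '[x, y] = - rip ('i%C *: x) y.
Proof.
by rewrite /rip linearZl_LR/= mulrC ReiNIm opprK.
Qed.

Lemma hdot_rip x y x' y' : rip x y = rip x' y' ->
  rip ('i%C *: x) y = rip ('i%C *: x') y' -> '[x, y] = '[x', y'].
Proof.
move=> h1 h2; apply/eqP; rewrite eq_complex !rip_i h2 eqxx andbT.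
by apply/eqP; exact: h1.
Qed.

Lemma nr_cauchy (u : nat -> H) :
  (forall e : R, 0 < e -> exists N, forall m n, (N <= m)%N -> (N <= n)%N ->
     nr (u m - u n) < e) ->
  exists x, forall e : R, 0 < e -> exists N, forall n, (N <= n)%N ->
    nr (u n - x) < e.
Proof.
move=> cu.
have cvgu : cvg (u @ \oo).
  apply: cauchy_cvg; apply: cauchy_exP => e e0.
  have [N hN] := cu (complex.Re e) (ltac:(by move: e0; rewrite ltcE/= => /andP[])).
  exists (u N); exists N => // n /= Nn.
  rewrite -ball_normE/= normE.
  have -> : e = (complex.Re e)%:C by rewrite RRe_real// gtr0_real.
  by rewrite ltcR; exact: hN.
exists (lim (u @ \oo)) => e e0.
move/cvgrPdist_lt : cvgu => /(_ e%:C); rewrite ltcR => /(_ e0)[N _ hN].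
by exists N => n Nn; have := hN n Nn; rewrite normE ltcR -nrN opprB.
Qed.

End real_inner_product.

Lemma small_eq0 {R : realType} (x c : R) :
  (forall e, 0 < e -> `|x| <= c * e) -> x = 0.
Proof.
move=> h; apply/eqP; rewrite -normr_le0 leNgt; apply/negP => x0.
have [c0|c0] := leP c 0.
  by have := h 1 ltr01; rewrite mulr1; lra.
have := h (`|x| / (2 * c)) (ltac:(by rewrite divr_gt0// mulr_gt0)).
have -> : c * (`|x| / (2 * c)) = `|x| / 2 by field; rewrite gt_eqF.
by lra.
Qed.

Lemma exists_invn {R : realType} (e : R) : 0 < e ->
  exists N, forall n, (N <= n)%N -> n.+1%:R^-1 < e.
Proof.
move=> e0; exists (Num.truncn e^-1) => n Nn.
rewrite -[e]invrK ltf_pV2 ?posrE ?invr_gt0//.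
by rewrite (lt_le_trans (truncnS_gt _))// ler_nat ltnS.
Qed.

(** * Self-adjoint operators *)

Section real_operators.
Context {R : realType} {H : hilbertType R}.
Implicit Types (x y z u v w : H) (a d e : R) (us vs : seq H) (D : set H).

Definition rsubspace D :=
  D 0 /\ forall a x y, D x -> D y -> D (a%:C *: x + y).

Definition rlinear D (T : H -> H) :=
  forall a x y, D x -> D y -> T (a%:C *: x + y) = a%:C *: T x + T y.

(** The last clause says that the adjoint has the graph of T. It also carries the density of D: for
    z orthogonal to D, the pair (0, z) lies in the adjoint graph, so z = T 0 = 0 ([rsa_perp]). *)
Definition rsa D (T : H -> H) := [/\ rsubspace D, rlinear D T &
  forall u v, (forall x, D x -> rip (T x) u = rip x v) <-> (D u /\ v = T u)].

Definition rsym (C : H -> H) :=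
  rlinear setT C /\ forall x y, rip (C x) y = rip x (C y).

Definition orth vs x := {in vs, forall v, rip x v = 0}.

Definition lower_bound vs D (T : H -> H) d :=
  forall x, D x -> orth vs x -> d * nr x <= nr (T x).

Fixpoint orthonormal_seq vs : Prop :=
  if vs is v :: vs' then [/\ nr v = 1, orth vs' v & orthonormal_seq vs'] else True.

Definition seqproj vs x := \sum_(v <- vs) (rip x v)%:C *: v.

Definition shiftop (T : H -> H) a x := T x - a%:C *: x.

Lemma shiftop0 T : shiftop T 0 = T.
Proof. by apply/funext => x; rewrite /shiftop scale0r subr0. Qed.

Lemma shiftopD T a b : shiftop (shiftop T a) b = shiftop T (a + b).
Proof.
by apply/funext => x; rewrite /shiftop rmorphD scalerDl opprD addrA.
Qed.

Lemma orth_nil x : orth [::] x. Proof. by []. Qed.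

Lemma orth_cons v vs x : orth (v :: vs) x <-> rip x v = 0 /\ orth vs x.
Proof.
split=> [h|[h1 h2] w].
  split; first by apply: h; rewrite inE eqxx.
  by move=> w wvs; apply: h; rewrite inE wvs orbT.
by rewrite inE => /orP[/eqP->//|]; exact: h2.
Qed.

Lemma orth_cat us vs x : orth (us ++ vs) x <-> orth us x /\ orth vs x.
Proof.
split=> [h|[h1 h2] w].
  by split=> w wvs; apply: h; rewrite mem_cat wvs ?orbT.
by rewrite mem_cat => /orP[/h1|/h2].
Qed.

Lemma orthZ vs a x : orth vs x -> orth vs (a%:C *: x).
Proof. by move=> hx v vvs; rewrite !ripE hx// mulr0. Qed.

Lemma orthB vs x y : orth vs x -> orth vs y -> orth vs (x - y).
Proof. by move=> hx hy v vvs; rewrite !ripE hx// hy// subr0. Qed.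

Section subspace.
Variables (D : set H) (T : H -> H).
Hypotheses (sD : rsubspace D) (lT : rlinear D T).

Lemma rdom0 : D 0. Proof. by case: sD. Qed.

Lemma rdomZ a x : D x -> D (a%:C *: x).
Proof. by move=> Dx; rewrite -[_ *: _]addr0; case: sD => D0; apply. Qed.

Lemma rdomD x y : D x -> D y -> D (x + y).
Proof. by move=> Dx Dy; rewrite -[x]scale1r -[1]/(1%:C); case: sD => D0; apply. Qed.

Lemma rdomB x y : D x -> D y -> D (x - y).
Proof.
move=> Dx Dy; apply: rdomD => //; rewrite -scaleN1r.
have -> : -1 = (-1)%:C :> R[i] by rewrite rmorphN.
exact: rdomZ.
Qed.

Lemma rlin0 : T 0 = 0.
Proof.
have /= := lT (-1) rdom0 rdom0; rewrite scaler0 addr0 => {1}->.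
by rewrite rmorphN scaleNr scale1r addNr.
Qed.

Lemma rlinZ a x : D x -> T (a%:C *: x) = a%:C *: T x.
Proof.
by move=> Dx; rewrite -[_ *: _]addr0 lT// ?rlin0 ?addr0//; exact: rdom0.
Qed.

Lemma rlinD x y : D x -> D y -> T (x + y) = T x + T y.
Proof. by move=> Dx Dy; rewrite -[x]scale1r -[1]/(1%:C) lT// !scale1r. Qed.

Lemma rlinB x y : D x -> D y -> T (x - y) = T x - T y.
Proof.
move=> Dx Dy; apply: (addIr (T y)); rewrite -rlinD ?subrK//.
exact: rdomB.
Qed.

End subspace.

Lemma rsubspaceT : rsubspace (setT : set H). Proof. by []. Qed.

Section rsa_theory.
Variables (D : set H) (T : H -> H).
Hypothesis sa : rsa D T.

Let sD : rsubspace D. Proof. by case: sa. Qed.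
Let lT : rlinear D T. Proof. by case: sa. Qed.

Lemma rsaS : rsubspace D. Proof. by case: sa. Qed.
Lemma rsaL : rlinear D T. Proof. by case: sa. Qed.

Lemma rsa_sym x y : D x -> D y -> rip (T x) y = rip x (T y).
Proof.
by move=> Dx Dy; case: sa => _ _ /(_ y (T y))[_ h]; exact: (h (conj Dy erefl)).
Qed.

Lemma rsa_adj u v : (forall x, D x -> rip (T x) u = rip x v) -> D u /\ v = T u.
Proof. by case: sa => _ _ /(_ u v)[]. Qed.

Lemma rsa_ker z : (forall x, D x -> rip (T x) z = 0) -> D z /\ T z = 0.
Proof.
move=> h; have [|Du Tu] := rsa_adj (u := z) (v := 0); last by [].
by move=> x Dx; rewrite h// rip0r.
Qed.

Lemma rsa_perp z : (forall x, D x -> rip x z = 0) -> z = 0.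
Proof.
move=> h; have [|_ ->] := rsa_adj (u := 0) (v := z); last exact: (rlin0 sD lT).
by move=> x Dx; rewrite h// rip0r.
Qed.

Lemma rsa_closed x y :
  (forall e, 0 < e -> exists u, [/\ D u, nr (u - x) < e & nr (T u - y) < e]) ->
  D x /\ T x = y.
Proof.
move=> h; have [|Du Tu] := rsa_adj (u := x) (v := y); last by [].
move=> z Dz; apply/eqP; rewrite -subr_eq0; apply/eqP.
apply: (@small_eq0 _ _ (nr (T z) + nr z)) => e e0.
have [u [Du ux Tuy]] := h e e0.
have -> : rip (T z) x - rip z y = rip z (T u - y) - rip (T z) (u - x).
  by rewrite !ripE (rsa_sym Dz Du); ring.
rewrite (le_trans (ler_normB _ _))//.
have := rip_CSabs z (T u - y); have := rip_CSabs (T z) (u - x).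
have := nr_ge0 z; have := nr_ge0 (T z).
by have := nr_ge0 (u - x); have := nr_ge0 (T u - y); nra.
Qed.

End rsa_theory.

Lemma rsa_add D T C : rsa D T -> rsym C -> rsa D (fun x => T x + C x).
Proof.
move=> sa [lC symC]; split; first exact: rsaS sa.
  move=> a x y Dx Dy; rewrite (rsaL sa)// lC// scalerDr.
  by rewrite addrACA.
move=> u v; split.
  move=> h; have [|Du e] := rsa_adj sa (u := u) (v := v - C u).
    by move=> x Dx; rewrite !ripE -symC -h// ripDl; ring.
  by split => //; rewrite -e subrK.
by move=> [Du ->] x Dx; rewrite !ripE (rsa_sym sa)// symC.
Qed.

Lemma rsymZ a : rsym (fun x => a%:C *: x).
Proof.
split; last by move=> x y; rewrite !ripE.
move=> b x y _ _; rewrite scalerDr !scalerA.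
by rewrite [_ * b%:C]mulrC.
Qed.

Lemma rsym_add C C' : rsym C -> rsym C' -> rsym (fun x => C x + C' x).
Proof.
move=> [lC sC] [lC' sC']; split.
  by move=> a x y _ _; rewrite lC// lC'// scalerDr addrACA.
by move=> x y; rewrite !ripE sC sC'.
Qed.

Lemma rsym_scale a C : rsym C -> rsym (fun x => a%:C *: C x).
Proof.
move=> [lC sC]; split; last by move=> x y; rewrite !ripE sC.
by move=> b x y _ _; rewrite lC// scalerDr !scalerA [_ * b%:C]mulrC.
Qed.

Lemma rsa_shift D T a : rsa D T -> rsa D (shiftop T a).
Proof.
rewrite /shiftop => sa; have := rsa_add sa (rsymZ (- a)); congr rsa.
by apply/funext => x; rewrite rmorphN scaleNr.
Qed.

Lemma lower_bound_weak vs us D T d d' : lower_bound vs D T d ->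
  {subset vs <= us} -> d' <= d -> lower_bound us D T d'.
Proof.
move=> h vu dd x Dx ox; rewrite (le_trans _ (h x Dx _))//.
  by rewrite ler_wpM2r// nr_ge0.
by move=> v /vu/ox.
Qed.

Lemma lower_bound_add vs D T (C : H -> H) d c : lower_bound vs D T d ->
  (forall x, nr (C x) <= c * nr x) -> lower_bound vs D (fun x => T x + C x) (d - c).
Proof.
move=> h hC x Dx ox; have := h x Dx ox; have := hC x.
have := nrD (T x + C x) (- C x); rewrite addrK nrN mulrBl; lra.
Qed.

(** A sequence of K minimizing the distance to w converges to some l with w - l orthogonal to K.
    Then both w and l are orthogonal to w - l, whence w = l. *)
Lemma perp_dense (K : set H) w : rsubspace K ->
  (forall z, (forall k, K k -> rip k z = 0) -> rip w z = 0) ->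
  forall e, 0 < e -> exists2 k, K k & nr (w - k) < e.
Proof.
move=> sK hw.
pose q k := rip (w - k) (w - k).
pose m := inf [set q k | k in K].
have lbm k : K k -> m <= q k.
  move=> Kk; apply: ge_inf; last by exists k.
  by exists 0 => _ [k' _ <-]; exact: rip_ge0.
have apx (n : nat) : exists k, K k /\ q k < m + n.+1%:R^-1.
  have [||_ [k Kk <-] qk] := @inf_adherent R [set q k | k in K] n.+1%:R^-1.
  - by rewrite invr_gt0.
  - split; first by exists (q 0), 0 => //; exact: (rdom0 sK).
    by exists 0 => _ [k' _ <-]; exact: rip_ge0.
  by exists k.
have [k hk] := choice apx.
have ck : forall e : R, 0 < e -> exists N, forall i j, (N <= i)%N -> (N <= j)%N ->
    nr (k i - k j) < e.
  move=> e e0; have [N hN] := @exists_invn _ (e ^+ 2 / 4) (ltac:(by rewrite divr_gt0 ?exprn_gt0)).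
  exists N => i j Ni Nj.
  have [Ki qi] := hk i; have [Kj qj] := hk j.
  suff : nr (k i - k j) ^+ 2 < e ^+ 2 by rewrite ltr_sqr ?nnegrE ?nr_ge0// ltW.
  (* Parallelogram identity: the midpoint of [k i] and [k j] is in K, hence at squared distance at
     least m from w. *)
  have := lbm _ (rdomZ sK (2^-1) (rdomD sK Ki Kj)).
  have := hN i Ni; have := hN j Nj.
  rewrite -rip_nr; move: qi qj; rewrite /q !ripE.
  rewrite (ripC (k i) w) (ripC (k j) w) (ripC (k j) (k i)).
  move: i.+1%:R^-1 j.+1%:R^-1 => r r'; lra.
have [l hl] := nr_cauchy ck.
have perp y : K y -> rip y (w - l) = 0.
  move=> Ky; apply: (@small_eq0 _ _ (2 * nr y)) => e e0.
  have [N1 h1] := hl e e0.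
  have [N2 h2] := @exists_invn _ (e ^+ 2) (ltac:(by rewrite exprn_gt0)).
  pose n := maxn N1 N2.
  have {}h1 := h1 n (leq_maxl _ _); have {}h2 := h2 n (leq_maxr _ _).
  have [Kn qn] := hk n.
  have h3 : `|rip y (w - k n)| <= nr y * e.
    have [->|y0] := eqVneq y 0; first by rewrite rip0l normr0 nr0 mul0r.
    have yp : 0 < nr y by rewrite lt_def nr_ge0 nr_eq0 y0.
    (* This t minimizes the distance from w to [k n] + t y. *)
    pose t := rip y (w - k n) / (nr y ^+ 2).
    have ht : t * nr y ^+ 2 = rip y (w - k n) by rewrite /t divfK// sqrf_eq0 gt_eqF.
    have := lbm (t%:C *: y + k n) (sK.2 t _ _ Ky Kn).
    have -> : q (t%:C *: y + k n) =
        q (k n) - 2 * t * rip y (w - k n) + t ^+ 2 * nr y ^+ 2.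
      rewrite /q -rip_nr !ripE (ripC w y) (ripC (k n) y) (ripC (k n) w).
      by ring.
    rewrite -ht => h4.
    suff : `|t * nr y ^+ 2| ^+ 2 <= (nr y * e) ^+ 2.
      by rewrite ler_sqr// nnegrE mulr_ge0// ltW.
    rewrite -normrX ger0_norm ?sqr_ge0//.
    have h5 : t ^+ 2 * nr y ^+ 2 <= e ^+ 2.
      by move: h2 qn h4; move: n.+1%:R^-1 (q (k n)) => r r' h2 qn h4; lra.
    have -> : (t * nr y ^+ 2) ^+ 2 = nr y ^+ 2 * (t ^+ 2 * nr y ^+ 2) by ring.
    by rewrite [leRHS]exprMn; apply: ler_wpM2l => //; exact: sqr_ge0.
  have -> : rip y (w - l) = rip y (w - k n) + rip y (k n - l) by rewrite !ripE; ring.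
  rewrite (le_trans (ler_normD _ _))//.
  have := rip_CSabs y (k n - l); have := nr_ge0 y; nra.
have wz := hw _ perp.
have lz : rip l (w - l) = 0.
  apply: (@small_eq0 _ _ (nr (w - l))) => e e0.
  have [N hN] := hl e e0; have [KN _] := hk N.
  have -> : rip l (w - l) = - rip (k N - l) (w - l).
    by rewrite ripDl ripNl (perp (k N))//; ring.
  rewrite normrN (le_trans (rip_CSabs _ _))// mulrC ler_wpM2l ?nr_ge0//.
  exact/ltW/hN.
have wl : w = l.
  apply/eqP; rewrite -subr_eq0 -nr_eq0 -sqrf_eq0 -rip_nr.
  by rewrite {1}ripDl ripNl wz lz subrr.
move=> e e0; have [N hN] := hl e e0; exists (k N); first by case: (hk N).
by rewrite wl -nrN opprB; exact: hN.
Qed.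

(** Stated for closed operators with dense range so as to cover A - z with z nonreal, which is not
    symmetric. The lower bound turns approximate solutions of T x = y into a Cauchy sequence. *)
Lemma closed_surj D T d : rsubspace D -> rlinear D T ->
  (forall x y, (forall e, 0 < e ->
     exists u, [/\ D u, nr (u - x) < e & nr (T u - y) < e]) -> D x /\ T x = y) ->
  (forall z, (forall x, D x -> rip (T x) z = 0) -> z = 0) ->
  0 < d -> lower_bound [::] D T d ->
  forall y, exists2 x, D x & T x = y.
Proof.
move=> sD lT cT kT d0 lb y.
have sK : rsubspace [set T x | x in D].
  split; first by exists 0; [exact: rdom0|exact: (rlin0 sD lT)].
  move=> a _ _ [x Dx <-] [x' Dx' <-]; exists (a%:C *: x + x').
    exact: sD.2.
  exact: lT.
have perp z : (forall k, [set T x | x in D] k -> rip k z = 0) -> rip y z = 0.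
  by move=> h; rewrite [z]kT ?rip0r// => x Dx; apply: h; exists x.
have apx (n : nat) : exists x, D x /\ nr (y - T x) < n.+1%:R^-1.
  have [|_ [x Dx <-] hx] := perp_dense sK perp (e := n.+1%:R^-1).
    by rewrite invr_gt0.
  by exists x.
have [x hx] := choice apx.
have [|l hl] := @nr_cauchy _ _ x.
  move=> e e0.
  have [N hN] := @exists_invn _ (d * e / 2) (ltac:(by rewrite divr_gt0 ?mulr_gt0)).
  exists N => i j Ni Nj; have [Di hi] := hx i; have [Dj hj] := hx j.
  have := lb _ (rdomB sD Di Dj) (orth_nil _).
  rewrite (rlinB sD lT)//.
  have := nrD (y - T (x j)) (- (y - T (x i))); rewrite nrN.
  have -> : y - T (x j) - (y - T (x i)) = T (x i) - T (x j).
    by apply: rip_ext => v; rewrite !ripE; ring.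
  have := hN i Ni; have := hN j Nj => h1 h2 h3 h4.
  rewrite -(ltr_pM2l d0); have := lt_trans hi h2; have := lt_trans hj h1; lra.
have [|Dl Tl] := cT l y; last by exists l.
move=> e e0; have [N1 h1] := hl e e0; have [N2 h2] := exists_invn e0.
pose n := maxn N1 N2; have [Dn hn] := hx n.
exists (x n); split => //; first exact/h1/leq_maxl.
by rewrite -nrN opprB (lt_trans hn)//; exact/h2/leq_maxr.
Qed.

Lemma lower_bound_inj D T d x : 0 < d -> lower_bound [::] D T d ->
  D x -> T x = 0 -> x = 0.
Proof.
move=> d0 lb Dx Tx; apply/eqP; rewrite -nr_eq0 eq_le nr_ge0 andbT.
by rewrite -(pmulr_rle0 _ d0) (le_trans (lb _ Dx (orth_nil _)))// Tx nr0.
Qed.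

Lemma rsa_surj D T d : rsa D T -> 0 < d -> lower_bound [::] D T d ->
  forall y, exists2 x, D x & T x = y.
Proof.
move=> sa d0 lb.
apply: (closed_surj (rsaS sa) (rsaL sa) (rsa_closed sa) _ d0 lb) => z h.
by have [Dz Tz] := rsa_ker sa h; exact: (lower_bound_inj d0 lb).
Qed.

End real_operators.

(** * Lower bounds off finitely many vectors *)

Section kernel_reduction.
Context {R : realType} {H : hilbertType R}.
Variables (D : set H) (T : H -> H).
Hypothesis sa : rsa D T.
Implicit Types (x y z u v w : H) (a d e : R) (us vs : seq H).

Let sD : rsubspace D := rsaS sa.
Let lT : rlinear D T := rsaL sa.

Definition in_kernel us := {in us, forall u, D u /\ T u = 0}.

(* If T is not bounded below on the complement W of [us ++ vs], normalizing
   [rip x v = 1] makes almost-null vectors of W a Cauchy sequence, whose limit is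
   in the kernel; no compactness is needed. *)
Lemma lower_bound_step us v vs d :
  lower_bound (us ++ v :: vs) D T d -> 0 < d ->
  (exists2 d', 0 < d' & lower_bound (us ++ vs) D T d') \/
  (exists x, [/\ D x, T x = 0, nr x = 1, orth us x &
     lower_bound ((x :: us) ++ vs) D T d]).
Proof.
move=> lb d0.
have lb' y : D y -> orth (us ++ vs) y -> rip y v = 0 -> d * nr y <= nr (T y).
  move=> Dy /orth_cat[ou ov] yv; apply: lb => //.
  by apply/orth_cat; split => //; apply/orth_cons.
have [[w [Dw ow wv]]|nw] := pselect (exists w, [/\ D w, orth (us ++ vs) w & rip w v = 1]);
    last first.
  left; exists d => // x Dx ox; apply: lb' => //.
  apply: contra_notP nw => /eqP xv; exists ((rip x v)^-1%:C *: x); split.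
  - exact: rdomZ.
  - exact: orthZ.
  - by rewrite ripZl mulVf.
have [[e e0 he]|ne] := pselect (exists2 e : R, 0 < e & forall x, D x -> orth (us ++ vs) x ->
    rip x v = 1 -> e <= nr (T x)).
  left.
  (* With p = <x, v>, the vector x - p w is orthogonal to v and |p| <= |T x| / e, so d |x| <= |T x|
     + |p| (|T w| + d |w|) <= c |T x|. *)
  pose c := 1 + (nr (T w) + d * nr w) / e.
  have c1 : 0 <= (nr (T w) + d * nr w) / e.
    by apply: divr_ge0; [apply: addr_ge0 => //; [|apply: mulr_ge0]|]; rewrite ?nr_ge0// ltW.
  have cp : 0 < c by rewrite /c; lra.
  exists (d / c); first by rewrite divr_gt0.
  move=> x Dx ox; set p := rip x v.
  have h1 : e * `|p| <= nr (T x).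
    have [p0|p0] := eqVneq p 0; first by rewrite p0 normr0 mulr0 nr_ge0.
    have := he (p^-1%:C *: x) (rdomZ sD _ Dx) (orthZ _ ox).
    rewrite ripZl mulVf// (rlinZ sD lT)// nrZ normfV => /(_ erefl).
    by rewrite ler_pdivlMl ?normr_gt0// mulrC.
  have := lb' (x - p%:C *: w) (rdomB sD Dx (rdomZ sD _ Dw)) (orthB ox (orthZ _ ow)).
  rewrite !ripE wv mulr1 subrr => /(_ erefl).
  rewrite (rlinB sD lT)//; last exact: rdomZ.
  rewrite (rlinZ sD lT)// => h2.
  have h3 := nrD (T x) (- (p%:C *: T w)).
  have h4 := nrD (x - p%:C *: w) (p%:C *: w).
  rewrite subrK in h4; rewrite nrN !nrZ in h3; rewrite nrZ in h4.
  rewrite mulrAC ler_pdivrMr//.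
  have h5 : `|p| <= nr (T x) / e by rewrite ler_pdivlMr// mulrC.
  have -> : nr (T x) * c = nr (T x) + nr (T x) / e * (nr (T w) + d * nr w).
    by rewrite /c; field; rewrite gt_eqF.
  have := ler_wpM2r (addr_ge0 (nr_ge0 (T w)) (mulr_ge0 (ltW d0) (nr_ge0 w))) h5.
  have := ler_wpM2l (ltW d0) h4.
  lra.
right.
have apx (n : nat) : exists x, [/\ D x, orth (us ++ vs) x, rip x v = 1 & nr (T x) < n.+1%:R^-1].
  apply: contra_notP ne => nx; exists n.+1%:R^-1; first by rewrite invr_gt0.
  move=> x Dx ox xv; rewrite leNgt; apply/negP => h; apply: nx; by exists x.
have [x hx] := choice apx.
have [|l hl] := @nr_cauchy _ _ x.
  move=> e e0.
  have [N hN] := @exists_invn _ (d * e / 2) (ltac:(by rewrite divr_gt0 ?mulr_gt0)).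
  exists N => i j Ni Nj; have [Di oi vi hi] := hx i; have [Dj oj vj hj] := hx j.
  have := lb' _ (rdomB sD Di Dj) (orthB oi oj); rewrite !ripE vi vj subrr => /(_ erefl).
  rewrite (rlinB sD lT)//.
  have := nrD (T (x i)) (- T (x j)); rewrite nrN.
  have := lt_trans hi (hN i Ni); have := lt_trans hj (hN j Nj) => h1 h2 h3 h4.
  by rewrite -(ltr_pM2l d0); lra.
have [|Dl Tl] := rsa_closed sa (x := l) (y := 0).
  move=> e e0; have [N1 h1] := hl e e0; have [N2 h2] := exists_invn e0.
  pose n := maxn N1 N2; have [Dn on vn hn] := hx n.
  exists (x n); split => //; first exact/h1/leq_maxl.
  by rewrite subr0 (lt_trans hn)//; exact/h2/leq_maxr.
have lrip u c : (forall n, rip (x n) u = c) -> rip l u = c.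
  move=> h; apply/eqP; rewrite -subr_eq0; apply/eqP.
  apply: (@small_eq0 _ _ (nr u)) => e e0; have [N hN] := hl e e0.
  have -> : rip l u - c = - rip (x N - l) u by rewrite !ripE h; ring.
  rewrite normrN (le_trans (rip_CSabs _ _))// mulrC ler_wpM2l ?nr_ge0//.
  exact/ltW/hN.
have lv : rip l v = 1 by apply: lrip => n; case: (hx n).
have ol : orth (us ++ vs) l.
  by move=> u uu; apply: lrip => n; case: (hx n) => _ + _ _; apply.
have l0 : nr l != 0.
  by rewrite nr_eq0; apply/eqP => l0; move: lv; rewrite l0 rip0l => /esym/eqP; rewrite oner_eq0.
have [olu olv] := (orth_cat us vs l).1 ol.
exists ((nr l)^-1%:C *: l); split.
- exact: rdomZ.
- by rewrite (rlinZ sD lT)// Tl scaler0.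
- by rewrite nrZ normfV ger0_norm ?nr_ge0// mulVf.
- exact: orthZ.
- move=> y Dy /orth_cat[/orth_cons[yl oyu] oyv].
  have {}yl : rip y l = 0.
    move/eqP: yl; rewrite ripZr mulf_eq0 invr_eq0 (negbTE l0)/=.
    by move/eqP.
  (* Moving y to y - p l reaches the complement of v. As T l = 0 the image is unchanged, and as y is
     orthogonal to l the norm does not decrease: d survives. *)
  set p := rip y v.
  have := lb' (y - p%:C *: l) (rdomB sD Dy (rdomZ sD _ Dl)) _ _.
  rewrite (rlinB sD lT)//; last exact: rdomZ.
  rewrite (rlinZ sD lT)// Tl scaler0 subr0 => h.
  apply: le_trans (h _ _).
  + apply: ler_wpM2l; first exact: ltW.
    apply: sqr_le; first exact: nr_ge0.
    rewrite -!rip_nr !ripE (ripC l y) yl.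
    have := rip_ge0 l; have := sqr_ge0 p; nra.
  + by apply: orthB; [apply/orth_cat|exact: orthZ].
  + by rewrite !ripE lv mulr1 subrr.
Qed.

(** Each vector of [vs] is either dropped, at the price of a smaller constant, or traded for a unit
    kernel vector orthogonal to those already found. *)
Lemma lower_bound_kernel vs us d : orthonormal_seq us -> in_kernel us ->
  lower_bound (us ++ vs) D T d -> 0 < d ->
  exists us' d', [/\ orthonormal_seq us', in_kernel us', 0 < d' &
    lower_bound us' D T d'].
Proof.
elim: vs us d => [|v vs IH] us d onu ku lb d0.
  by exists us, d; split => //; rewrite cats0 in lb.
have [[d' d'0 lb']|[x [Dx Tx x1 ox lb']]] := lower_bound_step lb d0.
  exact: (IH us d').
apply: (IH (x :: us) d) => //.
by move=> u; rewrite inE => /orP[/eqP->//|/ku].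
Qed.

End kernel_reduction.

(** * Projections onto finitely many kernel vectors *)

Section projection.
Context {R : realType} {H : hilbertType R}.
Implicit Types (x y z u v w : H) (a d e : R) (us vs : seq H) (D : set H).

Lemma seqproj_cons v vs x : seqproj (v :: vs) x = (rip x v)%:C *: v + seqproj vs x.
Proof. by rewrite /seqproj big_cons. Qed.

Lemma seqproj_rsym vs : rsym (seqproj vs).
Proof.
elim: vs => [|v vs [IH1 IH2]].
  split; first by move=> a x y _ _; rewrite /seqproj !big_nil scaler0 addr0.
  by move=> x y; rewrite /seqproj !big_nil rip0l rip0r.
split=> [a x y _ _|x y].
  apply: rip_ext => z; rewrite !seqproj_cons IH1// !ripE.
  by ring.
by rewrite !seqproj_cons !ripE IH2 (ripC v y); ring.
Qed.

Lemma rip_seqproj vs x y : orth vs y -> rip (seqproj vs x) y = 0.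
Proof.
elim: vs => [|v vs IH]; first by rewrite /seqproj big_nil rip0l.
by move=> /orth_cons[yv oy]; rewrite seqproj_cons !ripE IH// (ripC v) yv mulr0 addr0.
Qed.

Lemma orth_sub_seqproj vs x : orthonormal_seq vs -> orth vs (x - seqproj vs x).
Proof.
elim: vs => [//|v vs IH] /= [v1 ov onv]; rewrite seqproj_cons.
apply/orth_cons; split.
  by rewrite !ripE rip_nr v1 rip_seqproj//; ring.
move=> u uu; have := IH onv u uu; rewrite !ripE ov//; lra.
Qed.

Lemma seqproj_kernel D (T : H -> H) vs x : rsubspace D -> rlinear D T ->
  in_kernel D T vs -> D (seqproj vs x) /\ T (seqproj vs x) = 0.
Proof.
move=> sD lT; elim: vs => [|v vs IH] kv.
  by rewrite /seqproj big_nil; split; [exact: rdom0|exact: rlin0 lT].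
have [|Dp Tp] := IH; first by move=> u uu; apply: kv; rewrite inE uu orbT.
have [Dv Tv] := kv v (mem_head _ _).
rewrite seqproj_cons; split; first exact: sD.2.
by rewrite lT// Tv Tp scaler0 addr0.
Qed.

Lemma seqproj_pyth vs x : orthonormal_seq vs ->
  nr x ^+ 2 = nr (x - seqproj vs x) ^+ 2 + nr (seqproj vs x) ^+ 2.
Proof.
move=> onv; have := rip_seqproj x (orth_sub_seqproj x onv).
rewrite -!rip_nr; set p := seqproj vs x.
by rewrite !ripE (ripC p x); lra.
Qed.

(* [T - a] preserves both the span of [us] and its complement. *)
Lemma lower_bound_shift D T us d a b : rsa D T -> orthonormal_seq us ->
  in_kernel D T us -> lower_bound us D T d -> 0 <= b -> b <= `|a| ->
  b <= d - `|a| ->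
  lower_bound [::] D (shiftop T a) b.
Proof.
move=> sa onu ku lb b0 ba bd x Dx _; rewrite /shiftop.
have sD := rsaS sa; have lT := rsaL sa.
have [Dp Tp] := seqproj_kernel x sD lT ku.
set p := seqproj us x in Dp Tp; pose y := x - p.
have Dy : D y by exact: rdomB.
have oy : orth us y by exact: orth_sub_seqproj.
have py : rip p y = 0 by exact: rip_seqproj.
have xE : x = y + p by rewrite subrK.
have TyE : T x = T y by rewrite xE (rlinD lT)// Tp addr0.
have pTy : rip p (T y) = 0 by rewrite -(rsa_sym sa)// Tp rip0l.
have nx : nr x ^+ 2 = nr y ^+ 2 + nr p ^+ 2 by exact: seqproj_pyth.
have hy : b * nr y <= nr (T y - a%:C *: y).
  have := lb y Dy oy; have := nrD (T y - a%:C *: y) (a%:C *: y).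
  rewrite subrK nrZ => h1 h2.
  have := ler_wpM2r (nr_ge0 y) bd; rewrite mulrBl; lra.
suff : (b * nr x) ^+ 2 <= nr (T x - a%:C *: x) ^+ 2.
  by rewrite ler_sqr ?nnegrE ?mulr_ge0 ?nr_ge0.
have -> : nr (T x - a%:C *: x) ^+ 2 = nr (T y - a%:C *: y) ^+ 2 + a ^+ 2 * nr p ^+ 2.
  clear nx hy Dy oy; rewrite TyE {1}xE; clearbody y p.
  rewrite -!rip_nr !ripE (ripC (T y) p) (ripC y p) pTy py.
  by ring.
rewrite exprMn nx mulrDr lerD//.
  by rewrite -exprMn ler_sqr ?nnegrE ?mulr_ge0 ?nr_ge0.
by rewrite ler_wpM2r ?sqr_ge0// -[a ^+ 2]real_normK ?num_real// ler_sqr ?nnegrE.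
Qed.

(** Filling in the kernel: the sum acts as the identity on the span of [us] and as T on its
    complement, and the two images are orthogonal. *)
Lemma lower_bound_seqproj D T us d : rsa D T -> orthonormal_seq us ->
  in_kernel D T us -> lower_bound us D T d -> 0 < d ->
  lower_bound [::] D (fun x => T x + seqproj us x) (Num.min d 1).
Proof.
move=> sa onu ku lb d0 x Dx _; set m := Num.min d 1.
have m0 : 0 <= m by rewrite le_min !ltW//.
have md : m <= d by rewrite ge_min lexx.
have m1 : m <= 1 by rewrite ge_min lexx orbT.
have sD := rsaS sa; have lT := rsaL sa.
have [Dp Tp] := seqproj_kernel x sD lT ku.
set p := seqproj us x in Dp Tp *; pose y := x - p.
have Dy : D y by exact: rdomB.
have oy : orth us y by exact: orth_sub_seqproj.
have TyE : T x = T y by rewrite -[x](subrK p) (rlinD lT)// Tp addr0.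
have pTy : rip p (T y) = 0 by rewrite -(rsa_sym sa)// Tp rip0l.
have nx : nr x ^+ 2 = nr y ^+ 2 + nr p ^+ 2 by exact: seqproj_pyth.
suff : (m * nr x) ^+ 2 <= nr (T x + p) ^+ 2.
  by rewrite ler_sqr ?nnegrE ?mulr_ge0 ?nr_ge0.
have -> : nr (T x + p) ^+ 2 = nr (T y) ^+ 2 + nr p ^+ 2.
  by rewrite TyE -!rip_nr !ripE (ripC (T y) p) pTy; ring.
rewrite exprMn nx mulrDr lerD//.
  rewrite -exprMn ler_sqr ?nnegrE ?mulr_ge0 ?nr_ge0//.
  by rewrite (le_trans _ (lb y Dy oy))// ler_wpM2r// nr_ge0.
by rewrite ler_piMl ?sqr_ge0// expr_le1.
Qed.

End projection.

(** * From pointwise bounds to sharp gap bounds *)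

Section essential_gap.
Context {R : realType} {H : hilbertType R}.
Implicit Types (x y z u v w : H) (a d e r : R) (us vs : seq H) (D : set H).

Lemma rsa_inverse D T d : rsa D T -> 0 < d -> lower_bound [::] D T d ->
  exists S : H -> H, [/\ forall y, D (S y) /\ T (S y) = y,
    forall x, D x -> S (T x) = x, rsym S & forall y, d * nr (S y) <= nr y].
Proof.
move=> sa d0 lb; have sD := rsaS sa; have lT := rsaL sa.
have /choice[S hS] : forall y, exists x, D x /\ T x = y.
  by move=> y; have [x] := rsa_surj sa d0 lb y; exists x.
have inj x x' : D x -> D x' -> T x = T x' -> x = x'.
  move=> Dx Dx' e; apply/eqP; rewrite -subr_eq0 -nr_eq0 eq_le nr_ge0 andbT.
  rewrite -(pmulr_rle0 _ d0) (le_trans (lb _ _ (orth_nil _)))//; first exact: rdomB.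
  by rewrite (rlinB sD lT)// e subrr nr0.
exists S; split=> // [x Dx||y].
- by have [D1 T1] := hS (T x); exact: inj.
- split.
    move=> a x y _ _; have [Dx Tx] := hS x; have [Dy Ty] := hS y.
    have [D1 T1] := hS (a%:C *: x + y).
    by apply: inj => //; [exact: sD.2|rewrite T1 lT// Tx Ty].
  move=> x y; have [Dx Tx] := hS x; have [Dy Ty] := hS y.
  by rewrite -{1}Ty -{2}Tx (rsa_sym sa).
- by have [Dy {2}<-] := hS y; exact: lb (orth_nil _).
Qed.

(* Applied to p = S x, the bounds for T - d and T + d give
   [e ^ 2 |p| <= |(T ^ 2 - d ^ 2) p|], and T ^ 2 p = T x. *)
Lemma lower_bound_improve D T S vs d e : rsa D T ->
  (forall y, D (S y) /\ T (S y) = y) -> rsym S -> 0 < e -> e <= d ->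
  lower_bound vs D T d ->
  lower_bound vs D (shiftop T d) e -> lower_bound vs D (shiftop T (- d)) e ->
  forall x, D x -> orth (vs ++ map S vs) x ->
  (d ^+ 2 + e ^+ 4 / d ^+ 2) * nr x ^+ 2 <= nr (T x) ^+ 2.
Proof.
move=> sa hS [lS sS] e0 ed; have d0 := lt_le_trans e0 ed; move=> lb lbm lbp x Dx /orth_cat[ox oSx].
have sD := rsaS sa; have lT := rsaL sa.
have [Dp Tp] := hS x; set p := S x in Dp Tp.
have op : orth vs p by move=> v vv; rewrite sS; apply: oSx; exact: map_f.
have h1 := lb p Dp op; rewrite Tp in h1.
have Dw : D (x + d%:C *: p) by apply: rdomD => //; exact: rdomZ.
have ow : orth vs (x + d%:C *: p) by move=> v vv; rewrite !ripE ox// op// mulr0 addr0.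
have h2 := lbm _ Dw ow; have h3 := lbp _ Dp op.
rewrite /shiftop rmorphN scaleNr opprK Tp in h3; rewrite /shiftop in h2.
rewrite (rlinD lT) ?(rlinZ sD lT) ?Tp// in h2; last exact: rdomZ.
have h4 : e ^+ 2 * nr p <= nr (T x - (d ^+ 2)%:C *: p).
  apply: (@le_trans _ _ (e * nr (x + d%:C *: p))).
    by rewrite expr2 -mulrA; apply: ler_wpM2l => //; exact: ltW.
  rewrite (le_trans h2)//.
  have -> : T x + d%:C *: x - d%:C *: (x + d%:C *: p) = T x - (d ^+ 2)%:C *: p.
    by apply: rip_ext => z; rewrite !ripE; ring.
  by [].
have Tpx : rip (T x) p = nr x ^+ 2 by rewrite (rsa_sym sa)// Tp rip_nr.
have h5 : e ^+ 4 * nr p ^+ 2 <= nr (T x) ^+ 2 - 2 * d ^+ 2 * nr x ^+ 2 + d ^+ 4 * nr p ^+ 2.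
  have -> : nr (T x) ^+ 2 - 2 * d ^+ 2 * nr x ^+ 2 + d ^+ 4 * nr p ^+ 2 =
      nr (T x - (d ^+ 2)%:C *: p) ^+ 2.
    by rewrite -[RHS]rip_nr !ripE (ripC p (T x)) Tpx !rip_nr; ring.
  have -> : e ^+ 4 * nr p ^+ 2 = (e ^+ 2 * nr p) ^+ 2 by ring.
  by rewrite ler_sqr ?nnegrE ?nr_ge0// mulr_ge0 ?sqr_ge0 ?nr_ge0.
have h6 : d ^+ 2 * nr p ^+ 2 <= nr x ^+ 2.
  by rewrite -exprMn ler_sqr ?nnegrE ?mulr_ge0 ?nr_ge0// ltW.
have h7 : e ^+ 4 <= d ^+ 4 by rewrite ler_pXn2r// nnegrE ltW.
have h8 : nr p ^+ 2 <= nr x ^+ 2 / d ^+ 2 by rewrite ler_pdivlMr ?exprn_gt0// mulrC.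
(* By [h5], |T x|^2 >= 2 d^2 |x|^2 - (d^4 - e^4) |p|^2. Since e <= d, |p|^2 may be replaced there by
   its upper bound |x|^2 / d^2. *)
have h9 : 0 <= (d ^+ 4 - e ^+ 4) * (nr x ^+ 2 / d ^+ 2 - nr p ^+ 2).
  by rewrite mulr_ge0// subr_ge0.
have -> : (d ^+ 2 + e ^+ 4 / d ^+ 2) * nr x ^+ 2 =
    d ^+ 2 * nr x ^+ 2 + e ^+ 4 * (nr x ^+ 2 / d ^+ 2) by ring.
have hd : d ^+ 4 * (nr x ^+ 2 / d ^+ 2) = d ^+ 2 * nr x ^+ 2.
  by field; rewrite gt_eqF.
move: h9; rewrite mulrBl !mulrBr hd; move: h5.
set A := nr x ^+ 2 / d ^+ 2; set B := nr (T x) ^+ 2.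
by lra.
Qed.

(* [F] is either everything or the empty list alone: the former gives gaps of the
   essential spectrum, the latter gaps of the spectrum. *)
Lemma lower_bound_sup (F : seq H -> Prop) D T S d0 : rsa D T ->
  (forall y, D (S y) /\ T (S y) = y) -> rsym S ->
  (forall us vs, F us -> F vs -> F (us ++ vs)) ->
  (forall vs, F vs -> F (map S vs)) ->
  (forall h, `|h| <= d0 -> exists e vs,
     [/\ 0 < e, F vs & lower_bound vs D (shiftop T h) e]) ->
  0 <= d0 -> exists2 vs, F vs & lower_bound vs D T d0.
Proof.
move=> sa hS sS Fcat Fmap hF d00; apply: contrapT => nlb.
(* Let r be the supremum of the constants attained. The bounds at r and - r persist at d and - d for
   d in E close to r, and [lower_bound_improve] then yields a constant of E beyond r. *)
pose E := [set d | exists2 vs, F vs & lower_bound vs D T d].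
have Ed d : E d -> d <= d0.
  move=> [vs Fv lb]; rewrite leNgt; apply/negP => dd; apply: nlb; exists vs => //.
  by apply: (lower_bound_weak lb) => //; exact: ltW.
have [e0 [v0 [e00 Fv0 lb0]]] := hF 0 (ltac:(by rewrite normr0)).
rewrite shiftop0 in lb0.
have Ee0 : E e0 by exists v0.
have hE : has_sup E by split; [exists e0|exists d0; exact: Ed].
pose r := sup E.
have r0 : 0 < r by apply: (lt_le_trans e00); exact: sup_upper_bound.
have rd : r <= d0 by apply: ge_sup => //; exists e0.
have [e1 [v1 [e10 Fv1 lb1]]] := hF r (ltac:(by rewrite ger0_norm// ltW)).
have [e2 [v2 [e20 Fv2 lb2]]] := hF (- r) (ltac:(by rewrite normrN ger0_norm// ltW)).
pose e := Num.min (Num.min e1 e2) r / 2.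
have ep : 0 < e by rewrite divr_gt0// !lt_min e10 e20 r0.
have ee1 : 2 * e <= e1 by rewrite /e mulrC divfK// !ge_min lexx.
have ee2 : 2 * e <= e2 by rewrite /e mulrC divfK// !ge_min lexx orbT.
have eer : 2 * e <= r by rewrite /e mulrC divfK// !ge_min lexx orbT.
(* Chosen so that r - d < dl gives r^2 - d^2 < 2 r dl <= e^4 / r^2 <= e^4 / d^2, that is, q >
   r^2. *)
pose dl := Num.min e (e ^+ 4 / (2 * r ^+ 3)).
have dlp : 0 < dl.
  by rewrite lt_min ep/= divr_gt0 ?exprn_gt0// mulr_gt0 ?exprn_gt0.
have [d [v3 Fv3 lb3] hd] := sup_adherent dlp hE.
rewrite -/r in hd.
have dr : d <= r by apply: sup_upper_bound => //; exists v3.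
have dle : dl <= e by rewrite ge_min lexx.
have ed : e <= d by lra.
pose vs := v1 ++ v2 ++ v3.
have h3 : lower_bound vs D T d.
  by apply: (lower_bound_weak lb3) => // u uu; rewrite !mem_cat uu !orbT.
have shiftE s t : shiftop T s = (fun x => shiftop T t x + (t - s)%:C *: x).
  by apply/funext => x; rewrite /shiftop rmorphB scalerBl addrA subrK.
have bnd t x : nr (t%:C *: x) <= `|t| * nr x by rewrite nrZ.
have h1 : lower_bound vs D (shiftop T d) e.
  rewrite (shiftE d r); apply: (lower_bound_weak (lower_bound_add lb1 (bnd (r - d)))).
    by move=> u uu; rewrite !mem_cat uu.
  by rewrite ger0_norm ?subr_ge0//; lra.
have h2 : lower_bound vs D (shiftop T (- d)) e.
  rewrite (shiftE (- d) (- r)).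
  apply: (lower_bound_weak (lower_bound_add lb2 (bnd (- r - - d)))).
    by move=> u uu; rewrite !mem_cat uu !orbT.
  by rewrite opprK ler0_norm ?subr_le0; lra.
have himp := lower_bound_improve sa hS sS ep ed h3 h1 h2.
have d1 : 0 < d by lra.
pose q := d ^+ 2 + e ^+ 4 / d ^+ 2.
have q0 : 0 <= q by rewrite addr_ge0 ?divr_ge0 ?exprn_ge0 ?ltW.
have Eq : E (Num.sqrt q).
  have Fvs : F vs by apply: (Fcat) => //; exact: (Fcat).
  exists (vs ++ map S vs); first by apply: (Fcat) => //; exact: Fmap.
  move=> x Dx ox; apply: sqr_le; first exact: nr_ge0.
  by rewrite exprMn sqr_sqrtr//; exact: himp.
have qr : q <= r ^+ 2.
  rewrite -[q]sqr_sqrtr// ler_sqr ?nnegrE ?sqrtr_ge0//; last exact: ltW.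
  exact: sup_upper_bound.
have h4 : e ^+ 4 / r ^+ 2 <= e ^+ 4 / d ^+ 2.
  apply: ler_wpM2l; first by rewrite exprn_ge0// ltW.
  rewrite lef_pV2 ?posrE ?exprn_gt0//.
  by rewrite ler_sqr// nnegrE ltW.
have h5 : 2 * r * dl <= e ^+ 4 / r ^+ 2.
  have -> : e ^+ 4 / r ^+ 2 = 2 * r * (e ^+ 4 / (2 * r ^+ 3)).
    by field; rewrite gt_eqF.
  apply: ler_wpM2l; first by rewrite mulr_ge0// ltW.
  by rewrite ge_min lexx orbT.
by move: qr; rewrite /q => qr; nra.
Qed.

(* For T self-adjoint: 0 is not in the essential spectrum of T. *)
Definition fredholm D T := exists vs d, 0 < d /\ lower_bound vs D T d.

Lemma seqproj_orth us x : orth us x -> seqproj us x = 0.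
Proof.
move=> ox; apply: rip_ext => z; rewrite rip0l (seqproj_rsym us).2.
by rewrite ripC; exact: rip_seqproj.
Qed.

(** The supremum argument requires an inverse S, so the kernel of T is first filled in by
    [seqproj us]. This change is invisible on the complement of [us], and enlarging the lists by
    [us] transfers hypotheses and conclusion. *)
Lemma fredholm_gap D T d : rsa D T -> 0 <= d ->
  (forall h, `|h| <= d -> fredholm D (shiftop T h)) ->
  exists vs, lower_bound vs D T d.
Proof.
move=> sa d0 hf.
have [vs [e [e0 lb]]] := hf 0 (ltac:(by rewrite normr0)).
rewrite shiftop0 in lb.
have [|us [e' [onu ku e'0 lbu]]] := @lower_bound_kernel _ _ _ _ sa vs [::] e I _ lb e0.
  by [].
have lbT := lower_bound_seqproj sa onu ku lbu e'0.
have saT := rsa_add sa (seqproj_rsym us).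
have [|S [hS _ sS _]] := rsa_inverse saT _ lbT; first by rewrite lt_min e'0 ltr01.
have [||h habs|//|vs' _ lb'] := @lower_bound_sup (fun=> True) D _ S d saT hS sS; try by [].
  have [v [c [c0 lbc]]] := hf h habs.
  exists c, (us ++ v); split => // x Dx /orth_cat[ou ov].
  by rewrite /shiftop seqproj_orth// addr0; exact: lbc.
exists (us ++ vs') => x Dx /orth_cat[ou ov].
by have := lb' x Dx ov; rewrite seqproj_orth// addr0.
Qed.

(* If the spectrum of [T] meets [(-2 mu, 2 mu)] at most in [0], then
   [U = T (T - mu)^-1] satisfies [U >= 0] and [U ^ 2 >= (2 / 3) U], so that [U]
   is bounded below on the closure of its range, the complement of [ker T]. *)
Lemma isolated_lower_bound D T mu : rsa D T -> 0 < mu ->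
  lower_bound [::] D (shiftop T mu) mu ->
  lower_bound [::] D (shiftop T (- mu)) mu ->
  forall x, D x -> (forall z, D z -> T z = 0 -> rip x z = 0) ->
  2 / 3 * mu * nr x <= nr (T x).
Proof.
move=> sa mu0 lbm lbp x Dx ox.
have [S [hS SK sS bS]] := rsa_inverse (rsa_shift mu sa) mu0 lbm.
have [U [UE sU]] : exists U : H -> H, (forall y, U y = y + mu%:C *: S y) /\ rsym U.
  exists (fun y => y + mu%:C *: S y); split => //.
  have := rsym_add (rsymZ 1) (rsym_scale mu sS); congr rsym.
  by apply/funext => y; rewrite scale1r.
have TS y : T (S y) = U y.
  by have [_] := hS y; rewrite /shiftop UE => {2}<-; rewrite subrK.
(* U - 1 = mu S has norm at most 1, by the bound at mu. *)
have U2 y : nr (U y) ^+ 2 <= 2 * rip (U y) y.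
  have h : (mu * nr (S y)) ^+ 2 <= nr y ^+ 2.
    by rewrite ler_sqr ?nnegrE ?nr_ge0 ?mulr_ge0 ?nr_ge0 ?bS// ltW.
  have : nr (U y - y) ^+ 2 <= nr y ^+ 2.
    by rewrite UE addrAC subrr add0r nrZ exprMn real_normK ?num_real// -exprMn.
  by rewrite -!rip_nr !ripE (ripC y (U y)); lra.
(* Since (T + mu) S = 2 U - 1, the bound at - mu reads |U y - y| <= |2 U y - y|. *)
have U3 y : 2 * rip (U y) y <= 3 * nr (U y) ^+ 2.
  have := lbp _ (hS y).1 (orth_nil _).
  rewrite /shiftop TS rmorphN scaleNr opprK.
  have -> : mu%:C *: S y = U y - y by rewrite UE addrAC subrr add0r.
  have -> : mu * nr (S y) = nr (U y - y).
    by rewrite UE addrAC subrr add0r nrZ ger0_norm// ltW.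
  rewrite -ler_sqr ?nnegrE ?nr_ge0// -!rip_nr !ripE (ripC y (U y)); lra.
have U23 y : 2 / 3 * nr (U y) <= nr (U (U y)).
  set k := U y.
  (* Positivity of U (1 - 3 U / 2)^2: it gives 0 <= <U y, y> - 3 |k|^2 + 9/4 <U k, k>, and [U3]
     bounds the first term by 3/2 |k|^2. *)
  have := U2 (y - (3 / 2)%:C *: k).
  have lU : U (y - (3 / 2)%:C *: k) = k - (3 / 2)%:C *: U k.
    rewrite (rlinB (@rsubspaceT _ _) sU.1)// (rlinZ (@rsubspaceT _ _) sU.1)//.
  have := sqr_ge0 (nr (U (y - (3 / 2)%:C *: k))) => h0 h1.
  have {h0 h1} := le_trans h0 h1; rewrite lU !ripE (ripC k y).
  have -> : rip (U k) y = nr k ^+ 2 by rewrite sU.2 rip_nr.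
  rewrite rip_nr; have := U3 y; rewrite -/k (ripC k y) => h1 h2.
  have h3 : 2 / 3 * nr k ^+ 2 <= rip (U k) k by lra.
  have [->|k0] := eqVneq (nr k) 0; first by rewrite mulr0 nr_ge0.
  have kp : 0 < nr k by rewrite lt_def k0 nr_ge0.
  rewrite -(ler_pM2r kp); have := rip_CS (U k) k; lra.
have Ub y : nr (U y) <= 2 * nr y.
  have := U2 y; have := rip_CS (U y) y.
  have [->|k0] := eqVneq (nr (U y)) 0; first by rewrite mulr_ge0 ?nr_ge0.
  have kp : 0 < nr (U y) by rewrite lt_def k0 nr_ge0.
  by move=> h1 h2; rewrite -(ler_pM2l kp); lra.
(* As U w = T x and |w| >= mu |x|, it suffices to have |U w| >= 2/3 |w|. This passes from the range
   of U to w, which is orthogonal to the kernel of U, hence a limit of elements of the range. *)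
pose w := shiftop T mu x.
have Uw : U w = T x by rewrite -TS /w SK.
have sK : rsubspace (range U).
  split; first by exists 0 => //; rewrite (rlin0 (@rsubspaceT _ _) sU.1).
  move=> a _ _ [y _ <-] [z _ <-]; exists (a%:C *: y + z) => //.
  exact: sU.1.
have perp z : (forall k, range U k -> rip k z = 0) -> rip w z = 0.
  move=> h.
  have Uz : U z = 0.
    by apply: rip_extr => y; rewrite -sU.2 rip0r; apply: h; exists y.
  have zE : z = (- mu)%:C *: S z.
    by rewrite rmorphN scaleNr; apply/eqP; rewrite -addr_eq0 -UE Uz.
  have Dz : D z by rewrite zE; exact: (rdomZ (rsaS sa) _ (hS z).1).
  have Tz : T z = 0.
    by rewrite zE (rlinZ (rsaS sa) (rsaL sa)) ?TS ?Uz ?scaler0//; exact: (hS z).1.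
  by rewrite /w /shiftop !ripE (rsa_sym sa)// Tz rip0r ox//; ring.
have hw : mu * nr x <= nr w by exact: lbm (orth_nil _).
have Uw2 : 2 / 3 * nr w <= nr (U w).
  apply/ler_addgt0Pr => e e0.
  have [|_ [y _ <-] hk] := perp_dense sK perp (e := e / 3); first by rewrite divr_gt0.
  set k := U y in hk.
  have h1 := U23 y; rewrite -/k in h1.
  have h2 := Ub (w - k); rewrite (rlinB (@rsubspaceT _ _) sU.1)// in h2.
  have h3 := nrD (U w) (- (U w - U k)); rewrite nrN opprB addrCA subrr addr0 in h3.
  have h4 := nrD (w - k) k; rewrite subrK in h4.
  lra.
by rewrite -Uw (le_trans _ Uw2)// -mulrA; lra.
Qed.

End essential_gap.

(** * Essential spectrum *)

Section spectra.
Context {R : realType} {H : hilbertType R}.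
Implicit Types (A : operator H) (x y z u v w : H) (a b d e l : R).

Lemma domZ A (k : R[i]) x : dom A x -> dom A (k *: x).
Proof.
by move=> Ax; rewrite -[_ *: _]addr0; apply: dom_linear => //; exact: dom0.
Qed.

Lemma opfun0 A : A 0 = 0.
Proof.
have := @op_linear _ _ A (-1) 0 0 (dom0 A) (dom0 A); rewrite scaler0 addr0 => {1}->.
by rewrite scaleN1r addNr.
Qed.

Lemma opfunZ A (k : R[i]) x : dom A x -> A (k *: x) = k *: A x.
Proof.
by move=> Ax; rewrite -[_ *: _]addr0 op_linear//; [rewrite opfun0 addr0|exact: dom0].
Qed.

Lemma rip_iC x y : rip ('i%C *: x) y = - rip x ('i%C *: y).
Proof.
have h : complex.Im '[y, x] = - complex.Im '[x, y] by rewrite (hdotC y x); case: '[x, y].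
by rewrite (ripC x) -[rip ('i%C *: y) x]opprK -rip_i h -[LHS]opprK -rip_i !opprK.
Qed.

Lemma rip_im_self x : rip ('i%C *: x) x = 0.
Proof. by have := rip_iC x x; rewrite (ripC x ('i%C *: x)); lra. Qed.

Lemma rsa_of_self_adjoint A : self_adjoint A -> rsa (dom A) A.
Proof.
move=> [_ gA]; split.
- by split; [exact: dom0|move=> a x y; exact: dom_linear].
- by move=> a x y; exact: op_linear.
- move=> u v; split=> [h|[Du ->] x Dx]; last first.
    have : graph A (u, A u) by [].
    by rewrite -gA => /(_ x Dx); rewrite /rip => ->.
  have : adjoint_graph A (u, v).
    move=> x Dx /=; apply: hdot_rip; first exact: h.
    by rewrite -opfunZ// h//; exact: domZ.
  by rewrite gA.
Qed.

Lemma self_adjoint_of_rsa A : dense (dom A) -> rsa (dom A) A -> self_adjoint A.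
Proof.
move=> dA sa; split=> //; rewrite eqEsubset; split=> -[u v] /=.
  move=> h; apply: (rsa_adj sa) => x Dx.
  by rewrite /rip h.
move=> [/= Du ->] x Dx /=; apply: hdot_rip; first by rewrite (rsa_sym sa).
by rewrite -opfunZ// (rsa_sym sa)//; exact: domZ.
Qed.

Lemma linear_rlinear (B : {linear H -> H}) : rlinear setT B.
Proof. by move=> a x y _ _; exact: linearP. Qed.

Lemma symmetric_rsym (B : {linear H -> H}) : symmetric_op B -> rsym B.
Proof.
by move=> sB; split; [exact: linear_rlinear|move=> x y; rewrite /rip sB].
Qed.

Lemma self_adjoint_add A (B : {linear H -> H}) :
  self_adjoint A -> symmetric_op B -> self_adjoint (op_add A B).
Proof.
move=> sA sB; apply: self_adjoint_of_rsa; first by case: sA.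
exact: (rsa_add (rsa_of_self_adjoint sA) (symmetric_rsym sB)).
Qed.

Lemma resolventP A (z : R[i]) d : 0 < d ->
  (forall x, dom A x -> d * nr x <= nr (A x - z *: x)) ->
  (forall y, exists2 x, dom A x & A x - z *: x = y) ->
  resolvent_set A z.
Proof.
move=> d0 lb surj.
have /choice[S hS] : forall y, exists x, dom A x /\ A x - z *: x = y.
  by move=> y; have [x] := surj y; exists x.
exists S.
  exists d^-1 => y; have [Dy Sy] := hS y.
  rewrite !normE -rmorphM/= lecR -(ler_pM2l d0) mulrA mulfV ?gt_eqF// mul1r.
  by rewrite -{2}Sy; exact: lb.
split=> // x Dx; have [D1 e1] := hS (A x - z *: x).
apply/eqP; rewrite -subr_eq0 -nr_eq0 eq_le nr_ge0 andbT -(pmulr_rle0 _ d0).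
have Dd : dom A (S (A x - z *: x) - x).
  by rewrite addrC -scaleN1r; exact: dom_linear.
rewrite (le_trans (lb _ Dd))//.
rewrite (_ : A _ - _ = 0) ?nr0//.
rewrite [X in A X]addrC -[- x]scaleN1r op_linear// !scaleN1r.
have -> : A (S (A x - z *: x)) = A x - z *: x + z *: S (A x - z *: x).
  by rewrite -{2}e1 subrK.
set s := S _; rewrite scalerDr scalerN.
by apply: rip_ext => t; rewrite !ripE rip0l; ring.
Qed.

Lemma resolvent_real A l d : self_adjoint A -> 0 < d ->
  lower_bound [::] (dom A) (shiftop A l) d -> resolvent_set A l%:C.
Proof.
move=> sA d0 lb; apply: (@resolventP _ _ d) => //.
  by move=> x Dx; exact: lb (orth_nil _).
exact: (rsa_surj (rsa_shift l (rsa_of_self_adjoint sA)) d0 lb).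
Qed.

Lemma hdot_conj (k : R[i]) x y : '[k *: x, y] = '[x, k^*%C *: y].
Proof. by rewrite linearZl_LR linearZr_LR/= conjCK. Qed.

Lemma rip_conj (k : R[i]) x y : rip (k *: x) y = rip x (k^*%C *: y).
Proof. by rewrite /rip hdot_conj. Qed.

Lemma nonreal_lower_bound A (z : R[i]) x : self_adjoint A -> dom A x ->
  `|complex.Im z| * nr x <= nr (A x - z *: x).
Proof.
move=> sA Dx; have sa := rsa_of_self_adjoint sA.
set a := complex.Re z; set b := complex.Im z.
pose y := A x - a%:C *: x; pose i x := 'i%C *: x : H.
have zE : A x - z *: x = y - b%:C *: i x.
  rewrite /y /i scalerA [z in LHS]complexE scalerDl opprD addrA.
  by rewrite [_ * 'i%C]mulrC.
have xi : rip x (i x) = 0 by rewrite ripC rip_im_self.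
have ii : rip (i x) (i x) = nr x ^+ 2.
  by rewrite rip_iC scalerA -expr2 sqr_i scaleN1r ripNr opprK rip_nr.
have yi : rip y (i x) = 0.
  rewrite !ripE xi mulr0 subr0.
  have := rsa_sym sa Dx (domZ 'i%C Dx); rewrite opfunZ// => h.
  have := rip_iC x (A x); rewrite -h (ripC (i x)); rewrite /i; lra.
apply: sqr_le; first exact: nr_ge0.
rewrite zE exprMn real_normK ?num_real//.
clearbody y; rewrite -[nr (y - _) ^+ 2]rip_nr !ripE (ripC (i x) y) yi ii.
by have := rip_ge0 y; rewrite expr2; lra.
Qed.

Lemma resolvent_nonreal A (z : R[i]) : self_adjoint A ->
  complex.Im z != 0 -> resolvent_set A z.
Proof.
move=> sA z0; have b0 : 0 < `|complex.Im z| by rewrite normr_gt0.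
have sa := rsa_of_self_adjoint sA.
have lb x : dom A x -> `|complex.Im z| * nr x <= nr (A x - z *: x).
  exact: nonreal_lower_bound.
apply: (@resolventP _ _ `|complex.Im z|) => //.
apply: (@closed_surj _ _ (dom A) (fun x => A x - z *: x) `|complex.Im z|) => //.
- exact: rsaS sa.
- move=> a x y Dx Dy; rewrite (rsaL sa)// scalerDr scalerBr opprD addrACA.
  by rewrite !scalerA [z * _]mulrC.
- move=> x y h.
  have [|Dx Ax] := rsa_closed sa (x := x) (y := y + z *: x); last first.
    by split => //; rewrite Ax addrK.
  move=> e e0; pose c := 1 + complex.Re `|z|.
  have z1 : 0 <= complex.Re `|z| by rewrite -ler0c RRe_real ?normr_real.
  have c0 : 0 < c by rewrite /c; lra.
  have [u [Du ux uy]] := h (e / (2 * c)) (ltac:(by rewrite divr_gt0// mulr_gt0)).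
  have ec : e / (2 * c) * (2 * c) = e by rewrite divfK// mulf_neq0// gt_eqF.
  set q := e / (2 * c) in ux uy ec.
  have q0 : 0 < q by rewrite divr_gt0// mulr_gt0.
  have q1 : 2 * q + 2 * (complex.Re `|z| * q) = e by rewrite -ec /c; ring.
  have q2 : 0 <= complex.Re `|z| * q by rewrite mulr_ge0// ltW.
  exists u; split => //; first by lra.
  have -> : A u - (y + z *: x) = (A u - z *: u - y) + z *: (u - x).
    by apply: rip_ext => t; rewrite (scalerBr z u x) !ripE; ring.
  rewrite (le_lt_trans (nrD _ _))// nrZc.
  have := ler_wpM2l z1 (ltW ux); lra.
- move=> v h; have [|Dv Av] := rsa_adj sa (u := v) (v := z^*%C *: v).
    by move=> x Dx; have := h x Dx; rewrite ripDl ripNl rip_conj => /subr0_eq.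
  have := nonreal_lower_bound z^*%C sA Dv; rewrite -Av subrr nr0.
  have -> : complex.Im z^*%C = - complex.Im z by case: (z).
  rewrite normrN pmulr_rle0// => v0; apply/eqP.
  by rewrite -nr_eq0 eq_le v0 nr_ge0.
- by move=> x Dx _; exact: lb.
Qed.

Lemma resolvent_lower_bound A l : resolvent_set A l%:C ->
  exists2 d, 0 < d & lower_bound [::] (dom A) (shiftop A l) d.
Proof.
move=> [S [M hM] [_ SA]].
have M0 : 0 < `|M| + 1 by rewrite ltr_wpDl.
exists (`|M| + 1)^-1; first by rewrite invr_gt0.
move=> x Dx _; rewrite ler_pdivrMl//.
have := hM (A x - l%:C *: x); rewrite (SA _ Dx) !normE -rmorphM/= lecR => h.
rewrite (le_trans h)// ler_wpM2r ?nr_ge0//.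
by rewrite (le_trans (ler_norm _))// lerDl.
Qed.

(** Once the list consists of kernel vectors, it is either empty, and l is in the resolvent set, or
    it spans the eigenspace of l. In the latter case [lower_bound_shift] clears the real points at
    distance less than d' / 2 from l, other than l itself. *)
Lemma fredholm_not_essential A l : self_adjoint A ->
  fredholm (dom A) (shiftop A l) -> ~ essential_spectrum A l%:C.
Proof.
move=> sA [vs [d [d0 lb]]] [spl]; apply.
have sa := rsa_of_self_adjoint sA; have sal := rsa_shift l sa.
have [|us [d' [onu ku d'0 lbu]]] := @lower_bound_kernel _ _ _ _ sal vs [::] d I _ lb d0.
  by [].
case: us onu ku lbu => [|u us] onu ku lbu.
  by exfalso; apply: spl; exact: resolvent_real lbu.
have [Du Tu] := ku u (mem_head _ _).
have Au : A u = l%:C *: u by apply/eqP; rewrite -subr_eq0; apply/eqP.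
have u0 : u != 0 by case: onu => u1 _ _; rewrite -nr_eq0 u1 oner_eq0.
split.
- split; first exact: mem_set.
  exists (ball (l%:C : R[i]^o) (d' / 2)%:C).
    by apply: nbhsx_ballx; rewrite ltcR divr_gt0.
  rewrite eqEsubset; split=> [z [] /=|_ ->]; last first.
    by split => //; apply: ballxx; rewrite ltcR divr_gt0.
  rewrite -ball_normE/= => zl spz; apply: contrapT => zl'; apply: spz.
  have [zi|zi] := eqVneq (complex.Im z) 0; last exact: resolvent_nonreal.
  have zE : z = (complex.Re z)%:C by rewrite [LHS]complexE zi mulr0 addr0.
  rewrite zE; rewrite zE in zl zl'; set a := complex.Re z in zl zl' *.
  have al : `|a - l| < d' / 2.
    by move: zl; rewrite distrC -rmorphB normc_def/= expr0n/= addr0 sqrtr_sqr ltcR.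
  have al0 : 0 < `|a - l|.
    by rewrite normr_gt0 subr_eq0; apply: contra_notN zl' => /eqP->.
  pose b := Num.min `|a - l| (d' - `|a - l|).
  have b0 : 0 < b by rewrite lt_min al0 subr_gt0 (lt_trans al)// ltr_pdivrMr//; lra.
  apply: (@resolvent_real _ _ b) => //.
  have -> : shiftop A a = shiftop (shiftop A l) (a - l).
    by rewrite shiftopD addrC subrK.
  apply: (lower_bound_shift sal onu ku lbu); first exact: ltW.
    by rewrite ge_min lexx.
  by rewrite ge_min lexx orbT.
- by exists u.
- pose vs' := u :: us.
  exists (size vs'), (fun i => vs'`_i) => x [Dx Ax].
  exists (fun i => (rip x vs'`_i)%:C).
  have [Dp Tp] := seqproj_kernel x (rsaS sal) (rsaL sal) ku.
  have : x - seqproj vs' x = 0.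
    have Dd : dom A (x - seqproj vs' x) by exact: (rdomB (rsaS sal)).
    have := lbu _ Dd (orth_sub_seqproj x onu).
    rewrite (rlinB (rsaS sal) (rsaL sal))// Tp /shiftop Ax subrr subr0 nr0.
    rewrite pmulr_rle0// => h; apply/eqP.
    by rewrite -nr_eq0 eq_le h nr_ge0.
  by move/subr0_eq => {1}->; rewrite /seqproj (big_nth 0) big_mkord.
Qed.

(** At a discrete point, [lower_bound_sup] restricted to the empty list turns resolvent points
    around l + mu and l - mu into bounds mu there; [isolated_lower_bound] then bounds A - l off the
    finite-dimensional eigenspace. *)
Lemma not_essential_fredholm A l : self_adjoint A ->
  ~ essential_spectrum A l%:C -> fredholm (dom A) (shiftop A l).
Proof.
move=> sA nes; have sa := rsa_of_self_adjoint sA; have sal := rsa_shift l sa.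
have [rl|spl] := pselect (resolvent_set A l%:C).
  by have [d d0 lb] := resolvent_lower_bound rl; exists [::], d.
have [[_ [V nV VA]] _ [n [w hw]]] : discrete_spectrum A l%:C.
  by apply: contrapT => h; apply: nes.
have [e /= e0 eV] := (nbhs_ballP _ _).1 nV.
pose mu := complex.Re e / 3.
have ere : e = (complex.Re e)%:C by rewrite RRe_real// gtr0_real.
have e0' : 0 < complex.Re e by rewrite -ltcR -ere.
have mu0 : 0 < mu by rewrite divr_gt0.
have res a : a != l -> `|a - l| < 2 * mu -> resolvent_set A a%:C.
  move=> al al2; apply: contrapT => spa.
  have : (V `&` spectrum A) a%:C.
    split=> //; apply: eV; rewrite -ball_normE/= distrC -rmorphB.
    rewrite normc_def/= expr0n/= addr0 sqrtr_sqr ere ltcR (lt_trans al2)//.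
    by rewrite /mu; lra.
  by rewrite VA => -[] /eqP; rewrite (negbTE al).
have half s : `|s| = mu -> lower_bound [::] (dom A) (shiftop (shiftop A l) s) mu.
  move=> smu x Dx _; apply/ler_addgt0Pr => c c0.
  have [/eqP|x0] := eqVneq (nr x) 0.
    by rewrite nr_eq0 => /eqP->; rewrite nr0 mulr0 addr_ge0 ?nr_ge0// ltW.
  have xp : 0 < nr x by rewrite lt_def x0 nr_ge0.
  (* The radius mu about l + s would reach l itself, a spectral point, so only radii d < mu are
     allowed; this d loses at most c on the vector x. *)
  pose d := Num.max 0 (mu - c / nr x).
  have dmu : d < mu by rewrite gt_max mu0/= ltrBlDr ltrDl divr_gt0.
  have d0 : 0 <= d by rewrite le_max lexx.
  have hd : mu * nr x <= d * nr x + c.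
    have : mu - c / nr x <= d by rewrite le_max lexx orbT.
    by move/(ler_wpM2r (nr_ge0 x)); rewrite mulrBl divfK//; lra.
  suff lb : lower_bound [::] (dom A) (shiftop (shiftop A l) s) d.
    by rewrite (le_trans hd)// lerD2r; exact: lb (orth_nil _).
  have rls h : `|h| <= d -> exists2 d, 0 < d &
      lower_bound [::] (dom A) (shiftop (shiftop (shiftop A l) s) h) d.
    move=> hd'; rewrite !shiftopD; apply: resolvent_lower_bound; apply: res.
      rewrite addrC -subr_eq0 addrK.
      apply: contraTneq hd' => /eqP; rewrite addr_eq0 => /eqP sh.
      by rewrite -normrN -sh smu -ltNge.
    have -> : l + (s + h) - l = s + h by ring.
    by rewrite (le_lt_trans (ler_normD _ _))// smu; lra.
  have [d1 d10 lb1] := rls 0 (ltac:(by rewrite normr0)); rewrite shiftop0 in lb1.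
  have sas := rsa_shift s sal.
  have [S [hS _ sS _]] := rsa_inverse sas d10 lb1.
  have [|||| _ -> //] := @lower_bound_sup _ _ (fun vs => vs = [::]) (dom A) _ S d sas hS sS.
  - by move=> us vs -> ->.
  - by move=> vs ->.
  - by move=> h hd'; have [d2 d20 lb2] := rls h hd'; exists d2, [::].
  - by [].
have lbk := isolated_lower_bound sal mu0 (half mu (ger0_norm (ltW mu0)))
  (half (- mu) (ltac:(by rewrite normrN ger0_norm// ltW))).
pose vs := [seq w i | i <- enum 'I_n] ++ [seq 'i%C *: w i | i <- enum 'I_n].
exists vs, (2 / 3 * mu); split; first by rewrite mulr_gt0.
move=> x Dx /orth_cat[ow1 ow2]; apply: lbk => // z Dz Tz.
have [|c ->] := hw z.
  by split => //; apply/eqP; rewrite -subr_eq0; apply/eqP.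
have ow i : '[w i, x] = 0.
  have h1 : rip (w i) x = rip 0 x.
    by rewrite rip0l ripC; apply: ow1; apply: map_f; rewrite mem_enum.
  rewrite -(linear0l hdot x); apply: hdot_rip => //.
  rewrite scaler0 rip0l ripC; apply: ow2.
  by apply: (map_f (fun i => 'i%C *: w i)); rewrite mem_enum.
suff s0 : '[\sum_(i < n) c i *: w i, x] = 0 by rewrite ripC /rip s0 raddf0.
apply: (big_ind (fun y => '[y, x] = 0)); first by rewrite linear0l.
  by move=> u v u0 v0; rewrite linearDl/= u0 v0 addr0.
by move=> i _; rewrite linearZl_LR/= ow mulr0.
Qed.

End spectra.

(** * Spectral projections *)

Section finite_measures.
Context {R : realType}.
Local Open Scope ereal_scope.
Implicit Types mu : {measure set (measurableTypeR R) -> \bar R}.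

Lemma measurable_ray (l : R) : measurable (`]-oo, l]%classic : set (measurableTypeR R)).
Proof. exact: (@measurable_itv R `]-oo, l]). Qed.

Lemma measure_cdf_unique (m1 m2 : {measure set (measurableTypeR R) -> \bar R}) :
  (forall l : R, m1 `]-oo, l]%classic = m2 `]-oo, l]%classic) ->
  (forall l : R, m1 `]-oo, l]%classic < +oo) ->
  forall X, measurable X -> m1 X = m2 X.
Proof.
move=> m12 m1oo X mX.
have itvE (m : {measure set (measurableTypeR R) -> \bar R}) (a b : R) : (a <= b)%R ->
    m `]-oo, b]%classic < +oo ->
    m `]a, b]%classic = m `]-oo, b]%classic - m `]-oo, a]%classic.
  move=> ab moo.
  have -> : `]a, b]%classic = `]-oo, b]%classic `\` `]-oo, a]%classic.
    apply/seteqP; split => x /=; rewrite !in_itv/=.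
      by move=> /andP[ax xb]; split => //; apply/negP; rewrite -ltNge.
    by move=> [xb /negP]; rewrite -ltNge => ->.
  rewrite measureD; [|exact: measurable_ray|exact: measurable_ray|exact: moo].
  congr (_ - m _); apply/seteqP; split => x /=; rewrite !in_itv/=; first by case.
  by move=> xa; split => //; exact: le_trans ab.
apply: (@g_sigma_algebra_measure_unique _ R (measurableTypeR R) (@ocitv R)
  _ (fun n => `](- n%:R)%R, n%:R]%classic)) => //.
- by move=> Y; exact: sub_sigma_algebra.
- by move=> i; exact: is_ocitv.
- apply/seteqP; split => // x _ /=.
  by exists (Num.bound x); rewrite //= in_itv/= ltrNl ltrNbound ltW// ltr_bound.
- exact: ocitvI.
- move=> _ [[a b] _ <-] /=; have [ab|ba] := leP a b.
    by rewrite !itvE//; [congr (_ - _); exact: m12|rewrite -m12].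
  by rewrite set_itv_ge ?measure0// bnd_simp -leNgt ltW.
- move=> k; apply: le_lt_trans (m1oo k%:R); apply: le_measure; rewrite ?inE.
  + by apply: sub_sigma_algebra; exact: is_ocitv.
  + exact: measurable_ray.
  + by move=> x /=; rewrite !in_itv/= => /andP[].
Qed.

Lemma measurable_sqr :
  measurable_fun setT (fun l : measurableTypeR R => EFin ((l : R) ^+ 2)%R).
Proof.
by apply/measurable_EFinP; apply: measurable_funX; exact: measurable_id.
Qed.

Lemma integrable_id_of_sqr mu : mu setT < +oo ->
  \int[mu]_l (l ^+ 2)%:E < +oo -> mu.-integrable setT (fun l : R => l%:E).
Proof.
move=> muoo h.
have mid : measurable_fun setT (EFin : measurableTypeR R -> \bar R).
  by apply/measurable_EFinP; exact: measurable_id.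
apply/integrableP; split => //.
have msq := measurable_sqr.
apply: (@le_lt_trans _ _ (\int[mu]_l ((l ^+ 2)%:E + 1))).
  apply: ge0_le_integral => //.
  - exact: measurableT_comp.
  - exact: emeasurable_funD.
  - move=> l _; rewrite /= -EFinD lee_fin.
    have := sqr_ge0 (`|l| - 2^-1)%R.
    have -> : (l ^+ 2 = `|l| ^+ 2)%R by rewrite real_normK ?num_real.
    lra.
rewrite ge0_integralD//; last by move=> l _; rewrite lee_fin sqr_ge0.
by rewrite integral_cst// mul1e lte_add_pinfty.
Qed.

Lemma le_Rintegral_id mu (E m : R) : mu setT = m%:E ->
  mu.-integrable setT (fun l : R => l%:E) -> mu `]-oo, E]%classic = 0 ->
  (E * m <= \int[mu]_l l)%R.
Proof.
move=> mum iid mu0.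
have mE : measurable (`]E, +oo[%classic : set (measurableTypeR R)).
  exact: (@measurable_itv R `]E, +oo[).
have TD : [set: measurableTypeR R] `\` `]-oo, E]%classic = `]E, +oo[%classic.
  apply/seteqP; split => x /=; rewrite !in_itv/= andbT.
    by move=> [_ /negP]; rewrite -ltNge.
  by move=> Ex; split => //; apply/negP; rewrite -ltNge.
have ic : mu.-integrable setT (cst E%:E).
  apply/integrableP; split; first exact: measurable_cst.
  by rewrite (eq_integral (cst `|E%:E|))// integral_cst//= mum -EFinM ltry.
rewrite -lee_fin /Rintegral fineK; last exact: integrable_fin_num.
have -> : (E * m)%:E = \int[mu]_l (cst E%:E) l by rewrite integral_cst// mum.
rewrite (negligible_integral (measurable_ray E) _ iid mu0)//.
rewrite (negligible_integral (measurable_ray E) _ ic mu0)// TD.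
apply: le_integral => //.
- exact: (integrableS measurableT).
- exact: (integrableS measurableT).
- by move=> l; rewrite inE/= in_itv/= andbT lee_fin => /ltW.
Qed.

End finite_measures.

Section spectral_projections.
Context {R : realType} {H : hilbertType R}.
Implicit Types (x y z u v w : H) (D : set H) (T : H -> H) (E : R).

Definition reducing D T (P : H -> H) :=
  [/\ rsym P, forall x, P (P x) = P x, forall x, D x -> D (P x) &
      forall x, D x -> P (T x) = T (P x)].

(** With p = P x and q = x - p, the distribution functions add up, so the measure of x is the sum of
    those of p and q. Hence p and q are in the domain, and <x, A x> = <p, A p> + <q, A q>, which
    kills the cross term. For the form bound, P x = 0 means that the measure of x does not charge
    (-oo, E]. *)
Lemma spectral_family_reduces (A : operator H) (P : R -> H -> H) E :
  self_adjoint A -> spectral_family_of A P ->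
  reducing (dom A) A (P E) /\
  forall x, dom A x -> P E x = 0 -> E * nr x ^+ 2 <= rip x (A x).
Proof.
move=> sA [[oP leP _ _ cvP] hmu].
have sa := rsa_of_self_adjoint sA; have sD := rsaS sa; have lT := rsaL sa.
have sP l : rsym (P l).
  have [lP _ syP] := oP l; split; first by move=> a x y _ _; exact: lP.
  by move=> x y; rewrite /rip syP.
have iP l x : P l (P l x) = P l x by case: (oP l).
have PB l x y : P l (x - y) = P l x - P l y.
  exact: (rlinB (@rsubspaceT _ _) (sP l).1).
have PD l x y : P l (x + y) = P l x + P l y by exact: (rlinD (sP l).1).
have geP l x : E <= l -> P l (P E x) = P E x.
  move=> El; apply: rip_ext => z.
  by rewrite (sP l).2 (sP E).2 leP// -(sP E).2.
have pyth l x : nr (P l x) ^+ 2 = nr (P l (P E x)) ^+ 2 + nr (P l (x - P E x)) ^+ 2.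
  have o : rip (P l (P E x)) (P l (x - P E x)) = 0.
    rewrite -(sP l).2 iP.
    have [lE|/ltW El] := Order.TotalTheory.leP l E.
      by rewrite leP// (sP l).2 PB leP// subrr rip0r.
    by rewrite geP// (sP E).2 PB iP subrr rip0r.
  have xE : P l x = P l (P E x) + P l (x - P E x) by rewrite -PD addrC subrK.
  rewrite -!rip_nr xE ripDl !ripDr o.
  by rewrite (ripC _ (P l (P E x))) o; ring.
have mass x (mu : {measure set (measurableTypeR R) -> \bar R}) :
    (forall l : R, (mu `]-oo, l]%classic = (complex.Re `|P l x| ^+ 2)%:E)%E) ->
    mu setT = (nr x ^+ 2)%:E.
  move=> muE.
  have cov : \bigcup_n `]-oo, n%:R]%classic = [set: measurableTypeR R].
    apply/seteqP; split => // r _; exists (Num.bound r) => //=.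
    by rewrite in_itv/=; exact/ltW/ltr_bound.
  have c1 : mu (`]-oo, n%:R]%classic) @[n --> \oo] --> mu setT.
    rewrite -cov; apply: nondecreasing_cvg_mu.
    - by move=> n; exact: measurable_ray.
    - by rewrite cov; exact: measurableT.
    - move=> m n mn; apply/subsetPset => r /=; rewrite !in_itv/= => h.
      by rewrite (le_trans h)// ler_nat.
  have c2 : (nr (P n%:R x) ^+ 2)%:E @[n --> \oo] --> (nr x ^+ 2)%:E.
    apply: cvg_EFin; first by near=> n.
    apply: (@cvg_comp _ _ _ (fun n => nr (P n%:R x)) (fun r => r ^+ 2) _ (nbhs (nr x))).
      apply/cvgrPdist_lt => e e0.
      have := cvP x => /cvgrPdist_lt /(_ e%:C); rewrite ltcR => /(_ e0)[M [_ hM]].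
      exists (Num.bound M).+1 => // n /= Mn.
      have Mn' : M < n%:R.
        rewrite (lt_le_trans (ltr_bound M))//.
        by rewrite ler_nat ltnW.
      have := hM _ Mn'; rewrite normE ltcR; apply: le_lt_trans.
      have h1 := nrD (x - P n%:R x) (P n%:R x); have h2 := nrD (- (x - P n%:R x)) x.
      rewrite subrK in h1; rewrite nrN opprB subrK in h2.
      by rewrite ler_norml; apply/andP; split; lra.
    exact: exprn_continuous.
  apply: (cvg_unique _ c1) => //.
  suff -> : (fun n : nat => mu `]-oo, n%:R]%classic) = (fun n => (nr (P n%:R x) ^+ 2)%:E) by [].
  by apply/funext => n; rewrite muE.
have expand u v : dom A u -> dom A v ->
    rip (u + v) (A (u + v)) = rip u (A u) + 2 * rip (A u) v + rip v (A v).
  move=> Du Dv; rewrite (rlinD lT)// ripDl !ripDr -(rsa_sym sa Du Dv).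
  by rewrite (ripC v (A u)); ring.
have key x : dom A x -> dom A (P E x) /\ rip (A (P E x)) (x - P E x) = 0.
  move=> Dx; set p := P E x; set q := x - p.
  have [m [mE mD mA]] := hmu x; have [m1 [m1E m1D m1A]] := hmu p.
  have [m2 [m2E m2D m2A]] := hmu q.
  have mm : forall X, measurable X -> m X = measure_add m1 m2 X.
    apply: measure_cdf_unique => l; last by rewrite mE ltry.
    apply: (eq_trans _ (esym (measure_addE m1 m2 _))).
    by rewrite mE m1E m2E -EFinD; congr (_%:E); exact: pyth.
  have moo : (m setT < +oo)%E by rewrite (mass _ _ mE) ltry.
  have m1oo : (m1 setT < +oo)%E by rewrite (mass _ _ m1E) ltry.
  have m2oo : (m2 setT < +oo)%E by rewrite (mass _ _ m2E) ltry.
  have isq : (\int[m]_l (l ^+ 2)%:E = \int[m1]_l (l ^+ 2)%:E + \int[m2]_l (l ^+ 2)%:E)%E.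
    rewrite (eq_measure_integral (measure_add m1 m2)).
      rewrite ge0_integral_measure_add//; first by move=> l _; rewrite lee_fin sqr_ge0.
      exact: measurable_sqr.
    by move=> X mX _; exact: mm.
  have sqoo := (mD.1 Dx).
  have sq1 : (0 <= \int[m1]_l (l ^+ 2)%:E)%E.
    by apply: integral_ge0 => l _; rewrite lee_fin sqr_ge0.
  have sq2 : (0 <= \int[m2]_l (l ^+ 2)%:E)%E.
    by apply: integral_ge0 => l _; rewrite lee_fin sqr_ge0.
  have Dp : dom A p.
    apply: m1D.2; apply: le_lt_trans sqoo; rewrite isq; exact: leeDl.
  have Dq : dom A q.
    apply: m2D.2; apply: le_lt_trans sqoo; rewrite isq; exact: leeDr.
  split=> //.
  have i1 := integrable_id_of_sqr m1oo (m1D.1 Dp).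
  have i2 := integrable_id_of_sqr m2oo (m2D.1 Dq).
  have rx : rip x (A x) = \int[m]_l l by rewrite /rip mA.
  have rp : rip p (A p) = \int[m1]_l l by rewrite /rip m1A.
  have rq : rip q (A q) = \int[m2]_l l by rewrite /rip m2A.
  have : rip x (A x) = rip p (A p) + rip q (A q).
    rewrite rx rp rq /Rintegral (eq_measure_integral (measure_add m1 m2)); last first.
      by move=> X mX _; exact: mm.
    rewrite (integral_measure_add measurableT i1 i2).
    by rewrite fineD//; exact: integrable_fin_num.
  have xE : x = p + q by rewrite /q addrC subrK.
  have -> : rip x (A x) = rip p (A p) + 2 * rip (A p) q + rip q (A q).
    by rewrite {1 2}xE expand.
  lra.
(* Polarization: [key] is applied to P u + (v - P v), whose two components are P u and v - P v. *)
have cross u v : dom A u -> dom A v -> rip (A (P E u)) (v - P E v) = 0.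
  move=> Du Dv; have [Dpu _] := key u Du; have [Dpv _] := key v Dv.
  have [|_] := key (P E u + (v - P E v)).
    by apply: (rdomD sD) => //; exact: (rdomB sD).
  by rewrite PD PB !iP subrr addr0 addrAC subrr add0r.
split; first split => //.
- by move=> x Dx; case: (key x Dx).
- move=> x Dx; have [Dp _] := key x Dx; have Dq := rdomB sD Dx Dp.
  (* By density of the domain, [cross] shows that A (P x) lies in Ran P and that P kills A (x - P
     x); together they give the commutation. *)
  have z1 : A (P E x) - P E (A (P E x)) = 0.
    apply: (rsa_perp sa) => v Dv; rewrite ripDr ripNr -(sP E).2 -ripNl -ripDl ripC.
    exact: cross.
  have z2 : P E (A (x - P E x)) = 0.
    apply: (rsa_perp sa) => u Du; have [Dpu _] := key u Du.
    by rewrite -(sP E).2 -(rsa_sym sa)//; exact: cross.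
  have xE : x = (x - P E x) + P E x by rewrite subrK.
  by rewrite {1}xE (rlinD lT)// PD z2 add0r; apply/esym/subr0_eq.
- move=> x Dx Px0; have [m [mE mD mA]] := hmu x.
  have mx := mass _ _ mE.
  have -> : rip x (A x) = \int[m]_l l by rewrite /rip mA.
  apply: le_Rintegral_id => //; last by rewrite mE Px0 normr0 expr0n.
  by apply: integrable_id_of_sqr; [rewrite mx ltry|exact: mD.1].
Unshelve. all: by end_near. Qed.

(* The existence of spectral families is not needed: without one,
   [spectral_projection] is the identity, for which the claim is trivial. *)
Lemma spectral_projection_reduces (A : operator H) E : self_adjoint A ->
  reducing (dom A) A (spectral_projection A E) /\
  forall x, dom A x -> spectral_projection A E x = 0 ->
    E * nr x ^+ 2 <= rip x (A x).
Proof.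
move=> sA; rewrite /spectral_projection.
have [[P hP]|nP] := pselect (exists P, spectral_family_of A P).
  apply: spectral_family_reduces => //.
  by apply: (@xgetPex _ _ [set P | spectral_family_of A P]); exists P.
rewrite xgetPN; last by move=> P hP; apply: nP; exists P.
split; last by move=> x _ ->; rewrite nr0 expr0n/= mulr0 rip0l.
by split => //; split.
Qed.

End spectral_projections.

(** * Perturbation of gaps *)

Section perturbation.
Context {R : realType} {H : hilbertType R}.
Implicit Types (x y z u v w : H) (a b d e l m c k s : R) (vs : seq H) (D : set H).

Definition form_between (C : H -> H) c :=
  forall x, 0 <= rip x (C x) /\ rip x (C x) <= c * nr x ^+ 2.

(** Squared, this is C^2 <= c C. It follows from positivity of C at x - t C x with t = 1 / c and the
    upper bound of the form at C x; for c = 0, t = 1 does. *)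
Lemma form_between_centered C c x : rsym C -> 0 <= c -> form_between C c ->
  nr (C x - (c / 2)%:C *: x) <= c / 2 * nr x.
Proof.
move=> sC c0 fC.
have h : nr (C x) ^+ 2 <= c * rip x (C x).
  have [_ h1] := fC (C x); have [h2 h3] := fC x.
  have hq t : 0 <= rip x (C x) - 2 * t * nr (C x) ^+ 2 + t ^+ 2 * rip (C x) (C (C x)).
    have [+ _] := fC (x - t%:C *: C x).
    rewrite (rlinB (@rsubspaceT _ _) sC.1)// (rlinZ (@rsubspaceT _ _) sC.1)//.
    have e : rip x (C (C x)) = nr (C x) ^+ 2 by rewrite -sC.2 rip_nr.
    by rewrite !ripE e rip_nr; lra.
  have [c00|c00] := eqVneq c 0.
    by have := hq 1; move: h1 h3; rewrite c00 !mul0r; lra.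
  have cp : 0 < c by rewrite lt_def c00.
  have := hq c^-1 => h4.
  have h5 : c^-1 ^+ 2 * rip (C x) (C (C x)) <= c^-1 * nr (C x) ^+ 2.
    rewrite expr2 -mulrA ler_pM2l ?invr_gt0//.
    by rewrite ler_pdivrMl.
  have h6 : c^-1 * nr (C x) ^+ 2 <= rip x (C x) by lra.
  by rewrite ler_pdivrMl in h6.
apply: sqr_le; first by rewrite mulr_ge0 ?nr_ge0// divr_ge0.
rewrite exprMn -[nr (_ - _) ^+ 2]rip_nr !ripE (ripC (C x) x) !rip_nr.
by lra.
Qed.

Lemma lower_bound_perturb vs D T C c m d : rsym C -> 0 <= c -> form_between C c ->
  lower_bound vs D (shiftop T (m - c / 2)) d ->
  lower_bound vs D (shiftop (fun x => T x + C x) m) (d - c / 2).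
Proof.
move=> sC c0 fC lb.
have := lower_bound_add lb (fun x => form_between_centered x sC c0 fC).
suff -> : (fun x => shiftop T (m - c / 2) x + (C x - (c / 2)%:C *: x)) =
  shiftop (fun x => T x + C x) m by [].
by apply/funext => x; apply: rip_ext => z; rewrite /shiftop !ripE; ring.
Qed.

Definition fredholm_on D T a b :=
  forall l, a < l -> l < b -> fredholm D (shiftop T l).

Lemma fredholm_on_gap D T a b m d : rsa D T -> fredholm_on D T a b -> 0 <= d ->
  a < m - d -> m + d < b -> exists vs, lower_bound vs D (shiftop T m) d.
Proof.
move=> sa fab d0 am mb; apply: fredholm_gap => //; first exact: rsa_shift.
move=> h; rewrite ler_norml => /andP[h1 h2]; rewrite shiftopD; apply: fab; lra.
Qed.

Lemma fredholm_on_perturb D T C a b c : rsa D T -> fredholm_on D T a b ->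
  rsym C -> 0 <= c -> form_between C c ->
  fredholm_on D (fun x => T x + C x) (a + c) b.
Proof.
move=> sa fab sC c0 fC l l1 l2.
pose e := Num.min (l - (a + c)) (b - l) / 2.
have e0 : 0 < e by rewrite divr_gt0// lt_min !subr_gt0 l1 l2.
have e1 : 2 * e <= l - (a + c) by rewrite /e mulrC divfK// ge_min lexx.
have e2 : 2 * e <= b - l by rewrite /e mulrC divfK// ge_min lexx orbT.
(* The interval [l - c - e, l + e], centred at l - c / 2, lies in (a, b); adding C costs c / 2 of
   its radius and leaves e. *)
have [vs lb] : exists vs, lower_bound vs D (shiftop T (l - c / 2)) (c / 2 + e).
  by apply: (fredholm_on_gap sa fab); lra.
exists vs, (c / 2 + e - c / 2); split; first lra.
exact: lower_bound_perturb.
Qed.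

(** The new operator splits along P: it is T on Ran P, and T - k >= M - k >= m + d on the kernel of
    P. Only P x has to be orthogonal to [vs], hence the list [map P vs]. *)
Lemma lower_bound_reduced vs D T P M k m d : rsa D T -> reducing D T P ->
  (forall x, D x -> P x = 0 -> M * nr x ^+ 2 <= rip x (T x)) ->
  0 <= d -> m + d <= M - k -> lower_bound vs D (shiftop T m) d ->
  lower_bound (map P vs) D (shiftop (fun x => T x - k%:C *: (x - P x)) m) d.
Proof.
move=> sa [sP iP DP cP] hM d0 mdk lb x Dx ox.
have sD := rsaS sa; have lT := rsaL sa.
set p := P x; have [q qE] : exists q, q = x - p by exists (x - p).
have Dp : D p by exact: DP.
have Dq : D q by rewrite qE; exact: (rdomB sD).
have Pq : P q = 0 by rewrite qE (rlinB (@rsubspaceT _ _) sP.1)// iP subrr.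
have op : orth vs p by move=> v vv; rewrite sP.2; apply: ox; exact: map_f.
have [w wE] : exists w, w = T q - (k + m)%:C *: q by exists (T q - (k + m)%:C *: q).
have h1 : d * nr p <= nr (shiftop T m p) by exact: lb.
have h2 : d * nr q <= nr w.
  have [->|q0] := eqVneq (nr q) 0; first by rewrite mulr0 nr_ge0.
  have qp : 0 < nr q by rewrite lt_def q0 nr_ge0.
  have := hM q Dq Pq; have := rip_CS q w.
  rewrite {1}wE !ripE rip_nr => h3 h4.
  rewrite -(ler_pM2l qp).
  have : d * nr q ^+ 2 <= (M - k - m) * nr q ^+ 2.
    by rewrite ler_wpM2r ?sqr_ge0//; lra.
  by lra.
have pw : rip (shiftop T m p) w = 0.
  have -> : shiftop T m p = P (shiftop T m x).
    rewrite /shiftop (rlinB (@rsubspaceT _ _) sP.1)// (rlinZ (@rsubspaceT _ _) sP.1)//.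
    by rewrite cP.
  rewrite sP.2 wE (rlinB (@rsubspaceT _ _) sP.1)// (rlinZ (@rsubspaceT _ _) sP.1)//.
  by rewrite cP// Pq (rlin0 sD lT) scaler0 subrr rip0r.
have xE : x = p + q by rewrite qE addrC subrK.
have -> : shiftop (fun x => T x - k%:C *: (x - P x)) m x = shiftop T m p + w.
  apply: rip_ext => z; rewrite /shiftop wE -/p -qE {1 2}xE (rlinD lT)// !ripE.
  by ring.
have pq : rip p q = 0 by rewrite sP.2 Pq rip0r.
apply: sqr_le; first exact: nr_ge0.
rewrite exprMn {1}xE (rip_pyth pq) (rip_pyth pw).
have h3 : d ^+ 2 * nr p ^+ 2 <= nr (shiftop T m p) ^+ 2.
  by rewrite -exprMn ler_sqr ?nnegrE ?nr_ge0// mulr_ge0// nr_ge0.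
have h4 : d ^+ 2 * nr q ^+ 2 <= nr w ^+ 2.
  by rewrite -exprMn ler_sqr ?nnegrE ?nr_ge0// mulr_ge0// nr_ge0.
by lra.
Qed.

(* The coupling between [Ran P] and its complement is absorbed by adding
   [k (1 - P)], at the cost [s * eta], quadratic in [s]. *)
Lemma fredholm_on_step D T P B M N kappa k s a b : rsa D T -> reducing D T P ->
  (forall x, D x -> P x = 0 -> M * nr x ^+ 2 <= rip x (T x)) ->
  rsym B -> 0 <= kappa -> 0 <= N -> form_between B N ->
  (forall x, nr (B x) <= N * nr x) ->
  (forall x, P x = x -> kappa * nr x ^+ 2 <= rip x (B x)) ->
  0 < k -> b <= M - k -> 0 <= s -> 2 * (s * (N + kappa)) <= k ->
  let eta := 2 * s * (N + kappa) ^+ 2 / k in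
  fredholm_on D T a b ->
  fredholm_on D (fun x => T x + s%:C *: B x)
    (a + (s * (N + kappa) + k)) (b + s * (kappa - eta)).
Proof.
move=> sa rP hM sB ka0 N0 fB nB kB k0 bM s0 sNk eta fab l l1 l2.
have [sP iP DP cP] := rP.
have eta0 : 0 <= eta by rewrite divr_ge0 ?(ltW k0)// mulr_ge0 ?sqr_ge0// mulr_ge0.
(* T + s B - l = (T - k (1 - P)) + C - mu, where C has form between 0 and c. In mu - c the terms s
   eta cancel, which explains the lower edge of the statement. *)
pose mu := l - s * (kappa - eta).
pose c := s * (N + eta) + k.
have c0 : 0 <= c by rewrite addr_ge0 ?(ltW k0)// mulr_ge0// addr_ge0.
have mu1 : a + c < mu by rewrite /mu /c; lra.
have mu2 : mu < b by rewrite /mu; lra.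
pose e := Num.min (mu - (a + c)) (b - mu) / 2.
have e0 : 0 < e by rewrite divr_gt0// lt_min !subr_gt0 mu1 mu2.
have e1 : 2 * e <= mu - (a + c) by rewrite /e mulrC divfK// ge_min lexx.
have e2 : 2 * e <= b - mu by rewrite /e mulrC divfK// ge_min lexx orbT.
have [vs lb] : exists vs, lower_bound vs D (shiftop T (mu - c / 2)) (c / 2 + e).
  by apply: (fredholm_on_gap sa fab); lra.
have lb' := @lower_bound_reduced vs D T P M k (mu - c / 2) (c / 2 + e) sa rP hM
  (ltac:(lra)) (ltac:(lra)) lb.
pose C x := s%:C *: (B x + (eta - kappa)%:C *: x) + k%:C *: (1%:C *: x + (-1)%:C *: P x).
have sC : rsym C.
  apply: rsym_add; apply: rsym_scale; apply: rsym_add => //; try exact: rsymZ.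
  exact: rsym_scale.
have fC : form_between C c.
  move=> x; set p := P x; have [q qE] : exists q, q = x - p by exists (x - p).
  have Pq : P q = 0 by rewrite qE (rlinB (@rsubspaceT _ _) sP.1)// iP subrr.
  have pq : rip p q = 0 by rewrite sP.2 Pq rip0r.
  have xE : x = p + q by rewrite qE addrC subrK.
  have nx : nr x ^+ 2 = nr p ^+ 2 + nr q ^+ 2.
    by rewrite {1}xE rip_pyth.
  have xq : rip x x - rip x p = nr q ^+ 2.
    by rewrite -ripNr -ripDr -qE {1}xE ripDl pq rip_nr; ring.
  have CE : rip x (C x) = s * (rip x (B x) + (eta - kappa) * nr x ^+ 2) + k * nr q ^+ 2.
    by rewrite -xq -rip_nr /C !ripE; ring.
  have [_ Bx] := fB x; have [Bq _] := fB q.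
  have Bp := kB p (iP x).
  have Bpq : - (N * nr p * nr q) <= rip p (B q).
    have := rip_CSabs p (B q); rewrite ler_norml => /andP[h _].
    have := ler_wpM2l (nr_ge0 p) (nB q); lra.
  have xB : rip x (B x) = rip p (B p) + 2 * rip p (B q) + rip q (B q).
    rewrite {1 2}xE (rlinD sB.1)// ripDl !ripDr -(sB.2 q p) (ripC (B q) p).
    by ring.
  have np := nr_ge0 p; have nq := nr_ge0 q.
  rewrite CE; split; last first.
    have h1 : rip x (B x) + (eta - kappa) * nr x ^+ 2 <= (N + eta) * nr x ^+ 2.
      by have := mulr_ge0 ka0 (sqr_ge0 (nr x)); lra.
    have := ler_wpM2l s0 h1; have : k * nr q ^+ 2 <= k * nr x ^+ 2.
      by rewrite ler_wpM2l ?(ltW k0)// nx lerDr sqr_ge0.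
    by rewrite /c; lra.
  have h1 : eta * nr p ^+ 2 - 2 * (N + kappa) * nr p * nr q - (N + kappa) * nr q ^+ 2 <=
      rip x (B x) + (eta - kappa) * nr x ^+ 2.
    rewrite xB nx.
    have := mulr_ge0 ka0 (mulr_ge0 np nq); have := mulr_ge0 N0 (sqr_ge0 (nr q)).
    have := mulr_ge0 eta0 (sqr_ge0 (nr q)); lra.
  have h2 := ler_wpM2l s0 h1.
  have h3 : 2 * (s * (N + kappa)) * nr q ^+ 2 <= k * nr q ^+ 2.
    by rewrite ler_wpM2r ?sqr_ge0.
  (* Half of k |q|^2 absorbs the term s (N + kappa) |q|^2. The value of eta is the one for which the
     remaining quadratic form in |p| and |q| has zero discriminant, hence is a square up to a
     positive factor. *)
  have h4 : s * eta * k = 2 * (s * (N + kappa)) ^+ 2.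
    by rewrite /eta; field; rewrite gt_eqF.
  suff : 0 <= s * eta * nr p ^+ 2 - 2 * (s * (N + kappa)) * nr p * nr q + k / 2 * nr q ^+ 2.
    by lra.
  rewrite -(pmulr_rge0 _ k0).
  have square (u v y z : R) : u * k = 2 * v ^+ 2 ->
      k * (u * y ^+ 2 - 2 * v * y * z + k / 2 * z ^+ 2) = 2 * (v * y - k / 2 * z) ^+ 2.
    move=> h; have -> : 2 * (v * y - k / 2 * z) ^+ 2 =
      2 * v ^+ 2 * y ^+ 2 - 2 * v * k * y * z + k ^+ 2 / 2 * z ^+ 2 by field.
    by rewrite -h; field.
  by rewrite square// mulr_ge0// sqr_ge0.
exists (map P vs), (c / 2 + e - c / 2); split; first lra.
have := lower_bound_perturb sC c0 fC lb'.
suff -> : shiftop (fun x => T x - k%:C *: (x - P x) + C x) mu =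
  shiftop (fun x => T x + s%:C *: B x) l by [].
apply/funext => x; apply: rip_ext => z.
by rewrite /shiftop /C /mu !ripE; ring.
Qed.

Lemma opnorm_bound (B : {linear H -> H}) : bounded_op B ->
  0 <= opnorm B /\ forall x, nr (B x) <= opnorm B * nr x.
Proof.
move=> [M hM].
have M1 x : nr (B x) <= M * nr x by have := hM x; rewrite !normE -rmorphM/= lecR.
pose E := [set complex.Re `|B x| | x in [set x : H | `|x| <= 1]].
have hE : has_ubound E.
  exists `|M| => _ [x /= x1 <-].
  have {}x1 : nr x <= 1 by move: x1; rewrite normE -[1]/(1%:C) lecR.
  rewrite (le_trans (M1 x))// (le_trans (ler_wpM2r (nr_ge0 x) (ler_norm M)))//.
  by rewrite ler_piMr.
have ub x : nr x <= 1 -> nr (B x) <= opnorm B.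
  move=> x1; apply: ub_le_sup => //; exists x => //=.
  by rewrite normE -[1]/(1%:C) lecR.
split; first by rewrite (le_trans (nr_ge0 (B 0)))// ub// nr0.
move=> x; have [->|x0] := eqVneq x 0; first by rewrite linear0 !nr0 mulr0.
have xp : 0 < nr x by rewrite lt_def nr_eq0 x0 nr_ge0.
have := ub ((nr x)^-1%:C *: x); rewrite linearZ/= !nrZ normfV ger0_norm ?nr_ge0//.
by rewrite mulVf ?gt_eqF// => /(_ (lexx _)); rewrite ler_pdivrMl// mulrC.
Qed.

End perturbation.

(** * Climbing from A to A + B in small steps *)

Section iteration.
Context {R : realType} {H : hilbertType R}.
Variables (A : operator H) (B : {linear H -> H}) (a b kappa N : R).
Hypotheses (sA : self_adjoint A) (sB : symmetric_op B).
Hypotheses (N0 : 0 <= N) (ka0 : 0 <= kappa) (kaN : kappa <= N).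
Hypotheses (fB : form_between B N) (nB : forall x, nr (B x) <= N * nr x).
Hypothesis gapA : fredholm_on (dom A) A a b.
Hypothesis aNb : a + N < b.

Let T (t : R) (x : H) := A x + t%:C *: B x.

Let rB : rsym B. Proof. exact: symmetric_rsym. Qed.

Let rT t : rsa (dom A) (T t).
Proof. exact: (rsa_add (rsa_of_self_adjoint sA) (rsym_scale t rB)). Qed.

Hypothesis hP : forall t, 0 <= t <= 1 -> exists P : H -> H,
  [/\ reducing (dom A) (T t) P,
      forall x, dom A x -> P x = 0 -> (b + N) * nr x ^+ 2 <= rip x (T t x) &
      forall x, P x = x -> kappa * nr x ^+ 2 <= rip x (B x)].

Lemma fredholm_on_lower t : 0 <= t <= 1 -> fredholm_on (dom A) (T t) (a + N) b.
Proof.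
move=> /andP[t0 t1].
apply: (fredholm_on_perturb (rsa_of_self_adjoint sA) gapA (rsym_scale t rB)) => //.
move=> x; have [h1 h2] := fB x; rewrite ripZr mulr_ge0//; split => //.
by rewrite (le_trans _ h2)// ler_piMl.
Qed.

(** A step raises the lower edge by s (N + kappa) + k <= 2 k, which by [kgap] leaves it at most b;
    [fredholm_on_lower] then restores it to a + N, so this loss does not accumulate. *)
Lemma fredholm_on_iterate eps k s (n : nat) : 0 < k -> k <= eps ->
  2 * k <= b - (a + N) -> 0 <= s -> n%:R * s = 1 -> 2 * (s * (N + kappa)) <= k ->
  let eta := 2 * s * (N + kappa) ^+ 2 / k in
  forall j, (j <= n)%N ->
  fredholm_on (dom A) (T (j%:R * s)) (a + N) (b - eps + j%:R * s * (kappa - eta)).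
Proof.
move=> k0 keps kgap s0 ns sNk eta.
have eta0 : 0 <= eta by rewrite divr_ge0 ?(ltW k0)// mulr_ge0 ?sqr_ge0// mulr_ge0.
have js (j : nat) : (j <= n)%N -> 0 <= j%:R * s <= 1.
  by move=> jn; rewrite mulr_ge0//= -[X in _ <= X]ns ler_wpM2r// ler_nat.
elim=> [_|j IH jn].
  move=> l l1 l2; apply: fredholm_on_lower => //; first by rewrite mul0r lexx ler01.
  by move: l2; rewrite !mul0r addr0; lra.
have jn' : (j <= n)%N by exact: ltnW.
have [P [rP hM kP]] := hP (js _ jn').
have /andP[t0 t1] := js _ jn'.
(* Starting at b - eps with k <= eps, and climbing by at most kappa <= N, keeps the upper edge where
   subtracting k (1 - P) is harmless. *)
have bM : b - eps + j%:R * s * (kappa - eta) <= b + N - k.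
  have : j%:R * s * (kappa - eta) <= N.
    apply: (@le_trans _ _ (j%:R * s * kappa)); first by rewrite ler_wpM2l// gerBl.
    by rewrite (le_trans _ kaN)// ler_piMl.
  by move: (_ * (kappa - eta)) => u uN; lra.
have step := fredholm_on_step (rT _) rP hM rB ka0 N0 fB nB kP k0 bM s0 sNk (IH jn').
have jE : j.+1%:R * s = j%:R * s + s by rewrite -[j.+1]addn1 natrD mulrDl mul1r.
have TE : (fun x => T (j%:R * s) x + s%:C *: B x) = T (j.+1%:R * s).
  apply/funext => x; apply: rip_ext => z; rewrite jE /T !ripE.
  by ring.
rewrite TE -/eta in step.
move=> l l1 l2; have [lb|bl] := ltP l b; first exact: (fredholm_on_lower (js _ jn)).
apply: step; first lra.
by rewrite jE mulrDl addrA in l2.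
Qed.

Lemma fredholm_above l : b <= l -> l < b + kappa -> fredholm (dom A) (shiftop (T 1) l).
Proof.
move=> bl lbk.
(* The final edge b - eps + kappa - eta, with eta <= eps, is at least b + kappa - 2 eps > l. *)
pose eps := (b + kappa - l) / 3.
have eps0 : 0 < eps by rewrite divr_gt0// subr_gt0.
pose k := Num.min eps ((b - (a + N)) / 2).
have k0 : 0 < k by rewrite lt_min eps0 divr_gt0// subr_gt0.
have keps : k <= eps by rewrite ge_min lexx.
have kgap : 2 * k <= b - (a + N).
  have : k <= (b - (a + N)) / 2 by rewrite ge_min lexx orbT.
  lra.
have N1 : 0 < N + kappa + 1 by rewrite ltr_wpDl// addr_ge0.
(* A step s < d meets both requirements, 2 s (N + kappa) <= k and eta <= eps: the square of N +
   kappa + 1 dominates N + kappa as well as its square. *)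
pose d := k * Num.min 1 eps / (2 * (N + kappa + 1) ^+ 2).
have me0 : 0 < Num.min 1 eps by rewrite lt_min ltr01.
have d0 : 0 < d by rewrite divr_gt0 ?mulr_gt0// exprn_gt0.
have [n hn] := exists_invn d0; have {hn} := hn n (leqnn _).
set s := n.+1%:R^-1 => sd.
have s0 : 0 < s by rewrite invr_gt0.
have h0 : 2 * s * (N + kappa + 1) ^+ 2 <= k * Num.min 1 eps.
  have := ltW sd; rewrite /d ler_pdivlMr ?mulr_gt0 ?exprn_gt0//; lra.
have h1 : 2 * s * (N + kappa + 1) ^+ 2 <= k.
  by rewrite (le_trans h0)// ler_piMr ?(ltW k0)// ge_min lexx.
have h2 : 2 * s * (N + kappa + 1) ^+ 2 <= k * eps.
  by rewrite (le_trans h0)// ler_wpM2l ?(ltW k0)// ge_min lexx orbT.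
have Nk : 0 <= N + kappa by exact: addr_ge0.
have sNk : 2 * (s * (N + kappa)) <= k.
  have : 0 <= s * ((N + kappa) * (N + kappa) + (N + kappa) + 1).
    by rewrite mulr_ge0 ?(ltW s0)// !addr_ge0// mulr_ge0.
  lra.
pose eta := 2 * s * (N + kappa) ^+ 2 / k.
have eta_eps : eta <= eps.
  rewrite /eta ler_pdivrMr// [eps * k]mulrC (le_trans _ h2)//.
  rewrite ler_wpM2l ?mulr_ge0 ?(ltW s0)// ler_sqr ?nnegrE ?lerDl// ltW//.
have ns : n.+1%:R * s = 1 by rewrite mulfV// pnatr_eq0.
have := fredholm_on_iterate k0 keps kgap (ltW s0) ns sNk (leqnn n.+1).
rewrite ns mul1r -/eta; apply; first lra.
by rewrite /eps in eta_eps *; lra.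
Qed.

End iteration.

Theorem theorem3p18 (R : realType) (H : hilbertType R) (A : operator H)
    (a b kappa : R) (B : {linear H -> H}) :
  ~ finite_dimensional [set: H] ->
  self_adjoint A ->
  a < b ->
  [set l%:C | l in `]a, b[] `&` essential_spectrum A = set0 ->
  essential_spectrum A b%:C ->
  0 <= kappa ->
  bounded_op B -> symmetric_op B -> nonneg_op B ->
  opnorm B < b - a ->
  (* if B = 0, kappa > 0, A >= b and b is not an eigenvalue of A, the last
     hypothesis only concerns x = 0 and the conclusion fails; for B <> 0 this
     condition is void *)
  ((forall x, B x = 0) -> kappa = 0) ->
  (forall x, (\bigcup_(t in `[0, 1])
      range (spectral_projection (op_add A (t%:C \*: B)) (b + opnorm B))) x ->
    kappa%:C * `|x| ^+ 2 <= '[x, B x]) ->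
  [set l%:C | l in `[b, b + kappa[] `&` essential_spectrum (op_add A B) = set0.
Proof.
move=> _ sA ab gA essb ka0 bB sB pB Bab B0 hB.
have [N0 nB] := opnorm_bound bB; set N := opnorm B in N0 nB Bab hB.
have fB : form_between B N.
  move=> x; split; first by have := pB x; rewrite lecE => /andP[].
  by have := rip_CS x (B x); have := ler_wpM2l (nr_ge0 x) (nB x); lra.
have gapA : fredholm_on (dom A) A a b.
  move=> l al lb; apply: not_essential_fredholm => // essl.
  suff : set0 (l%:C) by [].
  by rewrite -gA; split => //; exists l => //=; rewrite in_itv/= al lb.
have kB (t : R) x : 0 <= t <= 1 ->
    spectral_projection (op_add A (t%:C \*: B)) (b + N) x = x ->
    kappa * nr x ^+ 2 <= rip x (B x).
  move=> t01 xE; have : kappa%:C * `|x| ^+ 2 <= '[x, B x].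
    by apply: hB; exists t => //=; exists x.
  by rewrite normE -rmorphXn -rmorphM lecE => /andP[].
have sAt t : self_adjoint (op_add A (t%:C \*: B)).
  have sBt x y : '[t%:C *: B x, y] = '[x, t%:C *: B y].
    by rewrite hdot_conj conjc_real sB linearZ.
  by apply: self_adjoint_add => // x y; exact: sBt.
apply/seteqP; split=> // _ [[l /= + <-] essl]; rewrite in_itv/= => /andP[bl lbk].
have kap : 0 < kappa by lra.
have Npos : 0 < N.
  rewrite lt_def N0 andbT; apply/eqP => N00.
  suff ka00 : kappa = 0 by move: kap; rewrite ka00 ltxx.
  apply: B0 => x; apply/eqP; rewrite -nr_eq0 eq_le nr_ge0 andbT.
  by rewrite (le_trans (nB x))// N00 mul0r.
(* A nonzero vector of Ran P, at t = 0, compares kappa with N. If P = 0, then A >= b + N, so A - b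
   is bounded below by N > 0 and b is not in the essential spectrum. *)
have kaN : kappa <= N.
  pose P := spectral_projection (op_add A (0%:C \*: B)) (b + N).
  have [[_ iP _ _] hM] := spectral_projection_reduces (b + N) (sAt 0).
  have [[x Px]|nP] := pselect (exists x, P x != 0).
    have := kB 0 (P x) (ltac:(by rewrite lexx ler01)) (iP x).
    have [_ h2] := fB (P x) => h1; have := le_trans h1 h2.
    by rewrite ler_pM2r// exprn_gt0// lt_def nr_eq0 Px nr_ge0.
  exfalso; apply: (fredholm_not_essential sA _ essb).
  exists [::], N; split => // x Dx _.
  have [->|x0] := eqVneq (nr x) 0; first by rewrite mulr0 nr_ge0.
  have xp : 0 < nr x by rewrite lt_def x0 nr_ge0.
  have Px0 : P x = 0.
    by apply/eqP; apply: contrapT => Px; apply: nP; exists x; apply/negP.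
  have := hM x Dx Px0; rewrite /= scale0r addr0 => h1.
  have := rip_CS x (shiftop A b x); rewrite {1}/shiftop !ripE rip_nr => h2.
  by rewrite -(ler_pM2l xp); lra.
apply: (fredholm_not_essential (self_adjoint_add sA sB) _ essl).
have -> : (op_add A B : H -> H) = (fun x => A x + 1%:C *: B x).
  by apply/funext => x; rewrite scale1r.
apply: (@fredholm_above _ _ A B a b kappa N) => //; first lra.
move=> t t01; exists (spectral_projection (op_add A (t%:C \*: B)) (b + N)).
have [rP hM] := spectral_projection_reduces (b + N) (sAt t).
by split => // x; exact: kB.
Qed.
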